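(* Let $\{(R_n,B_n)\}_{n=1}^\infty\subseteq\mathcal{D}_d$ be a sequence of admissible pairs in $\mathbb{R}^d$ with $\sup_{n\ge1}\|R_n\|<\infty$. Then the infinite convolution $$\mu=\delta_{R_1^{-1}B_1}*\delta_{(R_2R_1)^{-1}B_2}*\cdots*\delta_{(R_n\cdots R_1)^{-1}B_n}*\cdots$$ is a spectral measure with a spectrum contained in $\mathbb{Z}^d$.
   Context: $\mathcal{D}_d$ is the set of pairs $(R,B)$ with $R=\mathrm{diag}(m_1,\dots,m_d)$, $m_1,\dots,m_d\ge2$ integers, and $B$ a nonempty subset of $\{0,\dots,m_1-1\}\times\cdots\times\{0,\dots,m_d-1\}$. For a finite $A\subseteq\mathbb{R}^d$, $\delta_A=\frac{1}{\#A}\sum_{a\in A}\delta_a$; for a sequence in $\mathcal{D}_d$ the finite convolutions $\delta_{R_1^{-1}B_1}*\cdots*\delta_{(R_n\cdots R_1)^{-1}B_n}$ converge weakly, and $\mu$ denotes the limit. A pair $(R,B)$ ($R$ expanding integer matrix, $B\subseteq\mathbb{Z}^d$ finite) is admissible if there is a finite $L\subseteq\mathbb{Z}^d$ with $\#L=\#B$ such that $\big[\frac{1}{\sqrt{\#B}}e^{-2\pi i(R^{-1}b)\cdot\ell}\big]_{b\in B,\ell\in L}$ is unitary. A Borel probability measure is spectral if there is a countable $\Lambda\subseteq\mathbb{R}^d$ (a spectrum) with $\{e^{2\pi i\lambda\cdot x}\}_{\lambda\in\Lambda}$ an orthonormal basis of $L^2(\mu)$. $\|\cdot\|$ is the operator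 norm. *)

(* Defs.v *)
From HB Require Import structures.
From mathcomp Require Import all_boot all_order all_algebra.
From mathcomp Require Import all_classical all_reals all_analysis.
Set Implicit Arguments. Unset Strict Implicit. Unset Printing Implicit Defensive.
Import Order.TTheory GRing.Theory Num.Theory.
Import numFieldNormedType.Exports.
Local Open Scope classical_set_scope.
Local Open Scope ring_scope.

Definition dotp (R : realType) (d : nat) (x y : 'rV[R]_d) : R :=
  \sum_(i < d) x 0 i * y 0 i.

Definition mxapp (R : realType) (d : nat) (A : 'M[R]_d) (x : 'rV[R]_d)
  : 'rV[R]_d := (A *m x^T)^T.

Definition vecZ (R : realType) (d : nat) (b : 'rV[int]_d) : 'rV[R]_d :=
  map_mx (fun z : int => z%:~R) b.

Definition BorelRd (R : realType) (d : nat) :=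
  g_sigma_algebraType (@open 'rV[R]_d).

Definition diagR (R : realType) (d : nat) (m : 'I_d -> nat) : 'M[R]_d :=
  diag_mx (\row_i ((m i)%:R : R)).

Definition in_Dd (d : nat) (m : 'I_d -> nat) (B : seq 'rV[int]_d) : Prop :=
  (forall i, (2 <= m i)%N) /\ uniq B /\ B != [::] /\
  (forall b, b \in B -> forall i, 0 <= b 0 i /\ b 0 i < (m i)%:Z).

(* Admissible pair (A, B): there is L subset Z^d, #L = #B, such that the
   square matrix M = [ #B^{-1/2} exp(-2 pi i (A^{-1} b).l) ]_{b in B, l in L}
   is unitary.  Unitarity is written entrywise as M^* M = I:
   (M^* M)_{l l'} = #B^{-1} sum_{b in B} exp(2 pi i (A^{-1} b).(l - l')),
   whose real part must be [l == l'] and imaginary part 0. *)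
Definition admissible (R : realType) (d : nat) (A : 'M[R]_d)
    (B : seq 'rV[int]_d) : Prop :=
  exists L : seq 'rV[int]_d, uniq L /\ size L = size B /\
    forall l l', l \in L -> l' \in L ->
      (size B)%:R^-1 * \sum_(b <- B)
          cos (2 * pi * dotp (mxapp (invmx A) (vecZ R b)) (vecZ R (l - l')))
        = (l == l')%:R /\
      (size B)%:R^-1 * \sum_(b <- B)
          sin (2 * pi * dotp (mxapp (invmx A) (vecZ R b)) (vecZ R (l - l')))
        = 0.

(* P n = R_n ... R_0 (sequence indexed from 0 here, from 1 in the paper) *)
Fixpoint Pmat (R : realType) (d : nat) (m : nat -> 'I_d -> nat) (n : nat)
  : 'M[R]_d :=
  match n with
  | 0 => diagR R (m 0%N)
  | n'.+1 => diagR R (m n) *m Pmat R m n'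
  end.

Definition factor_pts (R : realType) (d : nat) (m : nat -> 'I_d -> nat)
    (B : nat -> seq 'rV[int]_d) (n : nat) : seq 'rV[R]_d :=
  [seq mxapp (invmx (Pmat R m n)) (vecZ R b) | b <- B n].

(* integral of f against delta_{A_1} * ... * delta_{A_k} (A_j duplicate-free) *)
Fixpoint conv_avg (R : realType) (d : nat) (As : seq (seq 'rV[R]_d))
    (f : 'rV[R]_d -> R) : R :=
  match As with
  | [::] => f 0
  | A :: As' => (size A)%:R^-1 * \sum_(a <- A) conv_avg As' (fun x => f (a + x))
  end.

Definition mu_n_int (R : realType) (d : nat) (m : nat -> 'I_d -> nat)
    (B : nat -> seq 'rV[int]_d) (n : nat) (f : 'rV[R]_d -> R) : R :=
  conv_avg [seq factor_pts R m B k | k <- iota 0 n] f.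

Definition weak_limit (R : realType) (d : nat) (m : nat -> 'I_d -> nat)
    (B : nat -> seq 'rV[int]_d) (mu : probability (BorelRd R d) R) : Prop :=
  forall f : 'rV[R]_d -> R, continuous f -> (exists M, forall x, `|f x| <= M) ->
    (fun n => (mu_n_int m B n f)%:E) @ \oo --> (\int[mu]_x (f x)%:E)%E.

(* Lam is a spectrum of mu: countable and {e_lam : x |-> exp(2 pi i lam.x)}
   is an orthonormal basis of L^2(mu) (complex-valued), i.e.
   (1) orthonormal: <e_l, e_l'> = int exp(2 pi i (l - l').x) dmu = [l == l'];
   (2) complete: a square-integrable f = u + i v with <f, e_l> = 0 for all
       l in Lam vanishes mu-a.e.  Here
       <f, e_l> = int (u cos t + v sin t) dmu + i int (v cos t - u sin t) dmu,
       t = 2 pi l.x. *)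
Definition spectrum_of (R : realType) (d : nat)
    (mu : probability (BorelRd R d) R) (Lam : set 'rV[R]_d) : Prop :=
  countable Lam /\
  (forall l l', Lam l -> Lam l' ->
     (\int[mu]_x (cos (2 * pi * dotp (l - l') x))%:E = ((l == l')%:R)%:E)%E /\
     (\int[mu]_x (sin (2 * pi * dotp (l - l') x))%:E = 0%:E)%E) /\
  (forall u v : BorelRd R d -> R,
     measurable_fun setT u -> measurable_fun setT v ->
     mu.-integrable setT (fun x => (u x ^+ 2)%:E) ->
     mu.-integrable setT (fun x => (v x ^+ 2)%:E) ->
     (forall l, Lam l ->
        (\int[mu]_x (u x * cos (2 * pi * dotp l x)
                     + v x * sin (2 * pi * dotp l x))%:E = 0%:E)%E /\
        (\int[mu]_x (v x * cos (2 * pi * dotp l x)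
                     - u x * sin (2 * pi * dotp l x))%:E = 0%:E)%E) ->
     {ae mu, forall x, u x = 0 /\ v x = 0}).

Definition spectral (R : realType) (d : nat)
    (mu : probability (BorelRd R d) R) : Prop :=
  exists Lam, spectrum_of mu Lam.

Definition in_Zd (R : realType) (d : nat) (Lam : set 'rV[R]_d) : Prop :=
  forall l, Lam l -> forall i, l 0 i \is a Num.int.

Definition sqnorm (R : realType) (d : nat) (x : 'rV[R]_d) : R :=
  \sum_(i < d) x 0 i ^+ 2.

(* Main.v *)
Require Import Defs.
From HB Require Import structures.
From mathcomp Require Import all_boot all_order all_algebra.
From mathcomp Require Import all_classical all_reals all_analysis.
From mathcomp Require Import measurable_realfun.
From mathcomp Require Import ring lra zify.
Import Order.TTheory GRing.Theory Num.Theory.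
Import numFieldNormedType.Exports.
Local Open Scope classical_set_scope.
Local Open Scope ring_scope.

(* Let F_n be the squared modulus of the Fourier transform of the n-th finite
   convolution; F_n decreases to |mu^|^2.  A spectrum L of the n-th convolution is
   characterised by sum_(l in L) F_n(xi + l) = 1 for all xi; it extends to the next
   level by adding (R_n ... R_1) l' with l' in a Hadamard companion of B_n, and its
   elements may be translated by R_n ... R_1 Z^d.

   Since the R_n take finitely many values, the tail measures are equi-positive:
   there is e > 0 such that for every tail nu and every xi some k in Z^d has
   |nu^(xi + k)|^2 >= e.  Indeed nu is carried by the cube [0,1]^d, and a cylinder
   can be chosen around which no mass is identified modulo Z^d with mass on the
   opposite face; testing e_xi nu against a periodic bump centred there gives the
   bound.  Choosing the translates accordingly makes F_n(xi + l) dominated by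
   |mu^(xi + l)|^2 / e on the n-th spectrum, and letting n tend to infinity yields
   sum_(l in Lam) |mu^(xi + l)|^2 = 1 for the union Lam of the spectra.

   Thus every exponential lies in the closed span of {e_l, l in Lam}, and a function
   orthogonal to all exponentials vanishes almost everywhere. *)

(** Periodicity is the obstacle to equi-positivity. A bump of period 1 centred at a is again near 1
    where a coordinate of x - a is near 1 or -1, and there cos(2 pi xi.(x - a)) may be negative and
    cancel the mass near a. Reserving two digit levels for each coordinate keeps the support away
    from such x by a margin depending only on d and on a bound M of all radices, so one constant
    serves every tail. The bump is a power of a product of cos^2, a trigonometric polynomial with
    nonnegative coefficients of sum 1; a high power makes the contribution away from a negligible
    against the mass of the cylinder.

    Complex exponentials are handled throughout by pairs of cosine and sine integrals. Uniqueness of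
    the Fourier transform comes from the bounded functions whose multiplication preserves a
    vanishing transform: they form an algebra closed under bounded pointwise limits, which contains
    cosines and sines and hence, successively, the indicators of half-spaces, boxes, open sets and
    Borel sets. *)

Section Scalar.
Context {R : realType}.
Implicit Types x y : R.

Lemma cosDint x (z : int) : cos (x + 2 * pi * z%:~R) = cos x.
Proof.
have P n y : cos (y + 2 * pi * n%:R) = cos y.
  rewrite -[RHS](periodicn (@cosD2pi R) n); congr (cos (_ + _)).
  by rewrite -[in RHS]mulr_natr -[pi *+ 2]mulr_natl.
case: (intP z) => [|n|n]; first by rewrite mulr0 addr0.
- exact: (P n.+1).
- by rewrite -(P n.+1 (x + _)) -addrA rmorphN /= mulrN addNr addr0.
Qed.

Lemma sinDint x (z : int) : sin (x + 2 * pi * z%:~R) = sin x.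
Proof. by rewrite -!cosBpihalf addrAC cosDint. Qed.

Lemma cos_dist x y : `|cos x - cos y| <= `|x - y|.
Proof.
wlog: x y / x <= y => [H|xy].
  by case/orP: (le_total x y) => /H //; rewrite distrC (distrC y).
have [|c _ E] := @MVT_segment R cos (fun t => - sin t) x y xy.
  by apply: continuous_subspaceT => t; exact: continuous_cos.
rewrite distrC E distrC normrM normrN.
by rewrite ler_piMl// sin_max.
Qed.

Lemma sin_dist x y : `|sin x - sin y| <= `|x - y|.
Proof.
rewrite -!cosBpihalf (le_trans (cos_dist _ _))//.
by rewrite (_ : x - pi / 2 - (y - pi / 2) = x - y)//; ring.
Qed.

End Scalar.

(** * The pairing, diagonal scaling and integer vectors *)

Section Vectors.
Context {R : realType} {d : nat}.
Implicit Types (x y z : 'rV[R]_d) (p : 'I_d -> nat).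

Lemma dotpC x y : dotp x y = dotp y x.
Proof. by apply: eq_bigr => i _; rewrite mulrC. Qed.

Lemma dotpDr x y z : dotp x (y + z) = dotp x y + dotp x z.
Proof.
by rewrite /dotp -big_split /=; apply: eq_bigr => i _; rewrite mxE mulrDr.
Qed.

Lemma dotpNr x y : dotp x (- y) = - dotp x y.
Proof. by rewrite /dotp -sumrN; apply: eq_bigr => i _; rewrite mxE mulrN. Qed.

Lemma dotpBr x y z : dotp x (y - z) = dotp x y - dotp x z.
Proof. by rewrite dotpDr dotpNr. Qed.

Lemma dotpDl x y z : dotp (x + y) z = dotp x z + dotp y z.
Proof. by rewrite !(dotpC _ z) dotpDr. Qed.

Lemma dotpNl x y : dotp (- x) y = - dotp x y.
Proof. by rewrite !(dotpC _ y) dotpNr. Qed.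

Lemma dotpBl x y z : dotp (x - y) z = dotp x z - dotp y z.
Proof. by rewrite dotpDl dotpNl. Qed.

Lemma dotp0r x : dotp x 0 = 0.
Proof. by rewrite /dotp big1// => i _; rewrite mxE mulr0. Qed.

Lemma dotp0l x : dotp 0 x = 0.
Proof. by rewrite dotpC dotp0r. Qed.

(** The inverse of the diagonal matrix of [p], written entrywise; [mxapp_invmx_diagR] eliminates the
    matrix inverses. *)
Definition scl p x : 'rV[R]_d := \row_i (x 0 i / (p i)%:R).

Lemma sclD p x y : scl p (x + y) = scl p x + scl p y.
Proof. by apply/rowP => i; rewrite !mxE mulrDl. Qed.

Lemma dotp_scl p x y : dotp x (scl p y) = dotp (scl p x) y.
Proof.
by apply: eq_bigr => i _; rewrite !mxE mulrA mulrAC.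
Qed.

Lemma mxapp_invmx_diagR p x : (forall i, (0 < p i)%N) ->
  mxapp (invmx (diagR R p)) x = scl p x.
Proof.
move=> p0; rewrite /mxapp.
have U : diagR R p \in unitmx.
  rewrite unitmxE det_diag unitfE; apply/prodf_neq0 => i _.
  by rewrite mxE pnatr_eq0 -lt0n.
have -> : x^T = diagR R p *m (scl p x)^T.
  apply/matrixP => i j; rewrite mul_diag_mx !mxE (ord1 j) mulrCA mulfV ?mulr1//.
  by rewrite pnatr_eq0 -lt0n.
by rewrite mulKmx // trmxK.
Qed.

Lemma vecZD (b c : 'rV[int]_d) : vecZ R (b + c) = vecZ R b + vecZ R c.
Proof. by apply/rowP => i; rewrite !mxE intrD. Qed.

Lemma vecZN (b : 'rV[int]_d) : vecZ R (- b) = - vecZ R b.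
Proof. by apply/rowP => i; rewrite !mxE mulrNz. Qed.

Lemma vecZB (b c : 'rV[int]_d) : vecZ R (b - c) = vecZ R b - vecZ R c.
Proof. by rewrite vecZD vecZN. Qed.

Lemma vecZ0 : vecZ R (0 : 'rV[int]_d) = 0.
Proof. by apply/rowP => i; rewrite !mxE. Qed.

Lemma vecZ_inj : injective (@vecZ R d).
Proof.
move=> b c /rowP E; apply/rowP => i; move: (E i); rewrite !mxE.
by move/eqP; rewrite eqr_int => /eqP.
Qed.

End Vectors.

(** * Finite convolutions as iterated averages *)

Section Average.
Context {R : realType} {d : nat}.
Notation V := 'rV[R]_d.
Implicit Types (A : seq V) (As : seq (seq V)) (f g : V -> R) (xi eta : V).

Definition avg A f : R := (size A)%:R^-1 * \sum_(a <- A) f a.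

Definition ecos xi (x : V) : R := cos (2 * pi * dotp xi x).
Definition esin xi (x : V) : R := sin (2 * pi * dotp xi x).

Lemma ecosD xi x y : ecos xi (x + y) = ecos xi x * ecos xi y - esin xi x * esin xi y.
Proof. by rewrite /ecos dotpDr mulrDr cosD. Qed.

Lemma esinD xi x y : esin xi (x + y) = esin xi x * ecos xi y + ecos xi x * esin xi y.
Proof. by rewrite /esin dotpDr mulrDr sinD. Qed.

Lemma ecosBl xi eta x :
  ecos (xi - eta) x = ecos xi x * ecos eta x + esin xi x * esin eta x.
Proof. by rewrite /ecos dotpBl mulrBr cosB. Qed.

Lemma esinBl xi eta x :
  esin (xi - eta) x = esin xi x * ecos eta x - ecos xi x * esin eta x.
Proof. by rewrite /esin dotpBl mulrBr sinB. Qed.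

Lemma ecosDl xi eta x :
  ecos (xi + eta) x = ecos xi x * ecos eta x - esin xi x * esin eta x.
Proof. by rewrite /ecos dotpDl mulrDr cosD. Qed.

Lemma esinDl xi eta x :
  esin (xi + eta) x = esin xi x * ecos eta x + ecos xi x * esin eta x.
Proof. by rewrite /esin dotpDl mulrDr sinD. Qed.

Lemma ecosB xi x y : ecos xi (x - y) = ecos xi x * ecos xi y + esin xi x * esin xi y.
Proof. by rewrite /ecos dotpBr mulrBr cosB. Qed.

Lemma esinB xi x y : esin xi (x - y) = esin xi x * ecos xi y - ecos xi x * esin xi y.
Proof. by rewrite /esin dotpBr mulrBr sinB. Qed.

(* Squared modulus of the Fourier transform of the uniform measure on [A]. *)
Definition pw A xi : R := avg A (ecos xi) ^+ 2 + avg A (esin xi) ^+ 2.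

Lemma pw_ge0 A xi : 0 <= pw A xi.
Proof. by rewrite addr_ge0 ?sqr_ge0. Qed.

Lemma pwE A xi :
  pw A xi = (size A)%:R^-2 * \sum_(a <- A) \sum_(b <- A) ecos xi (a - b).
Proof.
rewrite /pw /avg !exprMn -mulrDr exprVn; congr (_ * _).
rewrite !expr2 !mulr_suml -big_split /=; apply: eq_bigr => a _.
rewrite !mulr_sumr -big_split /=; apply: eq_bigr => b _.
by rewrite ecosB.
Qed.

Lemma ler_avg A f g : (forall x, x \in A -> f x <= g x) -> avg A f <= avg A g.
Proof.
move=> fg; rewrite /avg ler_wpM2l ?invr_ge0// !big_seq.
exact: ler_sum.
Qed.

Lemma avg_cst A c : A != [::] -> avg A (fun=> c) = c.
Proof.
move=> A0; rewrite /avg big_const_seq count_predT iter_addr_0 -[c *+ _]mulr_natl mulrA.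
by rewrite mulVf ?mul1r// pnatr_eq0 size_eq0.
Qed.

Lemma pw_le1 A xi : pw A xi <= 1.
Proof.
have [->|A0] := eqVneq A [::].
  by rewrite /pw /avg !big_nil !mulr0 expr0n /= addr0 ler01.
have -> : pw A xi = avg A (fun a => avg A (fun b => ecos xi (a - b))).
  rewrite pwE /avg -mulr_sumr mulrA; congr (_ * _).
  by rewrite -exprVn expr2.
rewrite -[leRHS](avg_cst A 1 A0); apply: ler_avg => x _.
rewrite -[leRHS](avg_cst A 1 A0); apply: ler_avg => y _.
exact: cos_le1.
Qed.

Lemma pw0 A : A != [::] -> pw A 0 = 1.
Proof.
move=> A0; rewrite /pw /avg.
under eq_bigr do rewrite /ecos dotp0l mulr0 cos0.
under [X in _ + (_ * X) ^+ 2]eq_bigr do rewrite /esin dotp0l mulr0 sin0.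
rewrite [X in _ + (_ * X) ^+ 2]big1// mulr0 expr0n addr0.
by rewrite -/(avg A (fun=> 1)) avg_cst// expr1n.
Qed.

Lemma pwD_int A xi eta :
  (forall a, a \in A -> dotp eta a \is a Num.int) -> pw A (xi + eta) = pw A xi.
Proof.
move=> int_eta.
have E a : a \in A -> ecos (xi + eta) a = ecos xi a /\ esin (xi + eta) a = esin xi a.
  move=> /int_eta/intrP[z Ez].
  by rewrite /ecos /esin dotpDl mulrDr Ez cosDint sinDint.
congr (_ ^+ 2 + _ ^+ 2); congr (_ * _);
  rewrite big_seq [RHS]big_seq; apply: eq_bigr => a /E[] //.
Qed.

Lemma eq_conv_avg As f g : f =1 g -> conv_avg As f = conv_avg As g.
Proof. by move=> /funext ->. Qed.

Lemma conv_avgD As f g :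
  conv_avg As (fun x => f x + g x) = conv_avg As f + conv_avg As g.
Proof.
elim: As f g => //= A As IH f g; rewrite -mulrDr -big_split /=.
by congr (_ * _); apply: eq_bigr => a _; rewrite IH.
Qed.

Lemma conv_avgZ As c f : conv_avg As (fun x => c * f x) = c * conv_avg As f.
Proof.
elim: As f => //= A As IH f; rewrite mulrCA [c * \sum_(_ <- _) _]mulr_sumr.
by congr (_ * _); apply: eq_bigr => a _; rewrite IH.
Qed.

(** The transform of a convolution is the product of the transforms; the two addition formulas are
    complex multiplication. *)
Lemma conv_avg_pw As xi :
  conv_avg As (ecos xi) ^+ 2 + conv_avg As (esin xi) ^+ 2 = \prod_(A <- As) pw A xi.
Proof.
elim: As => [|A As IH] /=.
  by rewrite big_nil /ecos /esin dotp0r mulr0 cos0 sin0 expr1n expr0n addr0.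
rewrite big_cons -IH /pw /avg.
set C := conv_avg As (ecos xi); set S := conv_avg As (esin xi).
have -> : \sum_(a <- A) conv_avg As (fun x => ecos xi (a + x)) =
    (\sum_(a <- A) ecos xi a) * C - (\sum_(a <- A) esin xi a) * S.
  rewrite !mulr_suml -sumrB; apply: eq_bigr => a _.
  under eq_conv_avg do rewrite ecosD -mulNr.
  by rewrite conv_avgD !conv_avgZ mulNr.
have -> : \sum_(a <- A) conv_avg As (fun x => esin xi (a + x)) =
    (\sum_(a <- A) esin xi a) * C + (\sum_(a <- A) ecos xi a) * S.
  rewrite !mulr_suml -big_split; apply: eq_bigr => a _.
  under eq_conv_avg do rewrite esinD.
  by rewrite conv_avgD !conv_avgZ.
ring.
Qed.

(** The support of the convolution: estimates of integrands are needed only there. *)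
Fixpoint pts As : set V :=
  match As with
  | [::] => [set 0]
  | A :: As' => [set x | exists a y, [/\ a \in A, pts As' y & x = a + y]]
  end.

Lemma ler_conv_avg As f g :
  (forall x, pts As x -> f x <= g x) -> conv_avg As f <= conv_avg As g.
Proof.
elim: As f g => [|A As IH] f g /= fg; first exact: fg.
rewrite ler_wpM2l ?invr_ge0// !big_seq; apply: ler_sum => a aA.
by apply: IH => y Hy; apply: fg; exists a, y.
Qed.

Lemma conv_avg_cst As c : all (fun A => A != [::]) As -> conv_avg As (fun=> c) = c.
Proof.
elim: As => //= A As IH /andP[A0 /IH ->].
by rewrite -/(avg A (fun=> c)) avg_cst.
Qed.

Lemma norm_conv_avg As f : `|conv_avg As f| <= conv_avg As (fun x => `|f x|).
Proof.
rewrite ler_norml; apply/andP; split; last first.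
  by apply: ler_conv_avg => x _; exact: ler_norm.
rewrite -mulN1r -conv_avgZ; apply: ler_conv_avg => x _.
by rewrite mulN1r lerNl -normrN ler_norm.
Qed.

(* Keeping only the atoms that start with the prescribed points [al]. *)
Lemma conv_avg_cylinder As1 As2 (al : seq V) f c : 
  size al = size As1 ->
  (forall k, (k < size As1)%N -> nth 0 al k \in nth [::] As1 k) ->
  (forall x, pts (As1 ++ As2) x -> 0 <= f x) ->
  (forall y, pts As2 y -> c <= f (\sum_(a <- al) a + y)) ->
  all (fun A => A != [::]) As2 ->
  (\prod_(A <- As1) (size A)%:R)^-1 * c <= conv_avg (As1 ++ As2) f.
Proof.
elim: As1 al f => [|A As1 IH] [|a al] f //=.
  move=> _ _ f0 fc As20; rewrite big_nil invr1 mul1r.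
  rewrite -{1}(conv_avg_cst _ c As20); apply: ler_conv_avg => y /fc.
  by rewrite big_nil add0r.
move=> [sz] Hal f0 fc As20; rewrite big_cons invfM -mulrA.
rewrite ler_wpM2l ?invr_ge0//.
have aA : a \in A by exact: (Hal 0%N).
rewrite (big_rem a)//=; apply: ler_wpDr.
  rewrite big_seq; apply: sumr_ge0 => b /mem_rem bA.
  have := @ler_conv_avg (As1 ++ As2) (fun=> 0) (fun x => f (b + x)).
  have -> : conv_avg (As1 ++ As2) (fun=> 0) = 0.
    rewrite -[RHS](mul0r (conv_avg (As1 ++ As2) (fun=> 0))) -conv_avgZ.
    by apply: eq_conv_avg => x; rewrite mul0r.
  by apply=> x Hx; apply: f0; exists b, x.
apply: (IH al) => //.
- by move=> k; exact: (Hal k.+1).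
- by move=> x Hx; apply: f0; exists a, x.
- by move=> y /fc; rewrite big_cons addrA.
Qed.

End Average.

(** * From Hadamard pairs to Parseval identities *)

Section Parseval.
Context {R : realType} {d : nat}.
Implicit Types (xs ls : seq 'rV[R]_d) (zeta : 'rV[R]_d).

(* The columns of a square complex matrix [C + iS] are orthogonal iff its rows
   are; the complex matrix is encoded by the real block matrix [[C, -S], [S, C]]. *)
Lemma dual_orthogonality xs ls :
  size ls = size xs -> xs != [::] ->
  (forall j j', (j < size xs)%N -> (j' < size xs)%N ->
     \sum_(x <- xs) ecos (nth 0 ls j - nth 0 ls j') x = (size xs)%:R * (j == j')%:R /\
     \sum_(x <- xs) esin (nth 0 ls j - nth 0 ls j') x = 0) ->
  forall i i', (i < size xs)%N -> (i' < size xs)%N ->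
     \sum_(l <- ls) ecos l (nth 0 xs i - nth 0 xs i') = (size xs)%:R * (i == i')%:R /\
     \sum_(l <- ls) esin l (nth 0 xs i - nth 0 xs i') = 0.
Proof.
move=> szl xs0 H; set N := size xs.
have N0 : N%:R != 0 :> R by rewrite pnatr_eq0 size_eq0.
pose C : 'M[R]_N := \matrix_(i, j) ecos (nth 0 ls j) (nth 0 xs i).
pose S : 'M[R]_N := \matrix_(i, j) esin (nth 0 ls j) (nth 0 xs i).
have E1 : C^T *m C + S^T *m S = N%:R%:M.
  apply/matrixP => j j'; rewrite !mxE -big_split /=.
  have [] := H j j' (ltn_ord _) (ltn_ord _) => HC _.
  move: HC; rewrite (big_nth 0) big_mkord mulr_natr => <-.
  by apply: eq_bigr => i _; rewrite !mxE ecosBl.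
have E2 : S^T *m C = C^T *m S.
  apply/eqP; rewrite -subr_eq0; apply/eqP/matrixP => j j'; rewrite !mxE -sumrB.
  have [] := H j j' (ltn_ord _) (ltn_ord _) => _.
  rewrite (big_nth 0) big_mkord => E0; apply: (etrans _ E0).
  by apply: eq_bigr => i _; rewrite !mxE esinBl.
pose U := block_mx C (- S) S C.
have UU : (N%:R^-1 *: U^T) *m U = 1%:M.
  rewrite -scalemxAl tr_block_mx mulmx_block E1 !linearN /= !mulNmx.
  rewrite opprK E2 !addNr [X in block_mx _ _ _ X]addrC E1.
  by rewrite -scalar_mx_block scale_scalar_mx mulVf.
(* A left inverse of a square matrix is a right inverse: U U^T = N I, and its blocks contain the
   relations between rows. *)
have := mulmx1C UU; rewrite -scalemxAr tr_block_mx mulmx_block !linearN /=.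
rewrite mulNmx opprK => /(congr1 (fun M => N%:R *: M)).
rewrite scalerA mulfV// scale1r scale_scalar_mx mulr1 scalar_mx_block.
case/eq_block_mx => D1 _ D2 _ i i' iN i'N.
split.
  move/matrixP: D1 => /(_ (Ordinal iN) (Ordinal i'N)); rewrite !mxE -big_split /=.
  rewrite mulr_natr => <-; rewrite (big_nth 0) szl big_mkord.
  by apply: eq_bigr => l _; rewrite !mxE ecosB.
move/matrixP: D2 => /(_ (Ordinal iN) (Ordinal i'N)); rewrite !mxE -sumrB => E0.
rewrite (big_nth 0) szl big_mkord; apply: (etrans _ E0).
by apply: eq_bigr => l _; rewrite !mxE esinB.
Qed.

(** Summing the double sum of [pwE] over [ls] first leaves only the diagonal: N terms of size N,
    against the factor N^-2. *)
Lemma parseval xs ls :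
  size ls = size xs -> xs != [::] ->
  (forall i i', (i < size xs)%N -> (i' < size xs)%N ->
     \sum_(l <- ls) ecos l (nth 0 xs i - nth 0 xs i') = (size xs)%:R * (i == i')%:R /\
     \sum_(l <- ls) esin l (nth 0 xs i - nth 0 xs i') = 0) ->
  forall zeta, \sum_(l <- ls) pw xs (zeta + l) = 1.
Proof.
move=> szl xs0 H zeta.
have N0 : (size xs)%:R != 0 :> R by rewrite pnatr_eq0 size_eq0.
under eq_bigr do rewrite pwE.
rewrite -mulr_sumr exchange_big /=.
under eq_bigr do rewrite exchange_big /=.
rewrite (big_nth 0) big_mkord.
under eq_bigr => i _.
  rewrite (big_nth 0) big_mkord.
  under eq_bigr => i' _.
    under eq_bigr do rewrite ecosDl.
    rewrite sumrB -!mulr_sumr.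
    have [] := H i i' (ltn_ord _) (ltn_ord _) => -> ->.
    rewrite mulr0 subr0.
    over.
  rewrite (bigD1 i)//= eqxx subrr /ecos dotp0r mulr0 cos0 mul1r mulr1 big1 ?addr0.
    over.
  by move=> j /negPf; rewrite -val_eqE eq_sym => /= ->; rewrite !mulr0.
rewrite sumr_const card_ord -[(size xs)%:R *+ _]mulr_natl.
by rewrite -expr2 -exprVn -exprMn mulVf// expr1n.
Qed.

Lemma admissible_parseval (p : 'I_d -> nat) (B : seq 'rV[int]_d) :
  (forall i, (0 < p i)%N) -> B != [::] -> admissible (diagR R p) B ->
  exists L : seq 'rV[int]_d, forall zeta,
    \sum_(l <- 0 :: L) pw [seq scl p (vecZ R b) | b <- B] (zeta + vecZ R l) = 1.
Proof.
move=> p0 B0 [L [uL [sL HL]]].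
set xs := [seq _ | b <- B].
have szx : size xs = size B by rewrite size_map.
have xs0 : xs != [::] by rewrite -size_eq0 szx size_eq0.
have NB : (size B)%:R != 0 :> R by rewrite pnatr_eq0 size_eq0.
have P zeta : \sum_(l <- [seq vecZ R l | l <- L]) pw xs (zeta + l) = 1.
  apply: parseval => //; first by rewrite size_map szx.
  apply: dual_orthogonality => //; first by rewrite size_map szx.
  rewrite szx -sL => j j' jL j'L; rewrite !(nth_map 0)// -!vecZB.
  have [C S] := HL _ _ (mem_nth 0 jL) (mem_nth 0 j'L).
  rewrite -(nth_uniq 0 jL j'L uL) sL.
  rewrite -C mulrA mulfV// mul1r; split.
    rewrite big_map; apply: eq_bigr => b _.
    by rewrite mxapp_invmx_diagR// dotpC.
  rewrite big_map; apply/eqP; move/eqP: S; rewrite mulf_eq0 invr_eq0 (negPf NB) /=.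
  move/eqP => E0; apply/eqP; apply: (etrans _ E0); apply: eq_bigr => b _.
  by rewrite mxapp_invmx_diagR// dotpC.
case: L uL sL {HL} P => [|l0 L] _ sL P.
  by move: B0; rewrite -size_eq0 -sL.
(* Translating by one of its elements keeps the identity for every zeta and puts 0 first, so that
   each spectrum can be a prefix of the next. *)
exists [seq l - l0 | l <- L] => zeta.
rewrite -(P (zeta - vecZ R l0)) big_map !big_cons big_map vecZ0 addr0 subrK.
by congr (_ + _); apply: eq_bigr => l _; rewrite vecZB addrAC addrA.
Qed.

End Parseval.

(** * Levels of the convolution and periodicity of its transform *)

Section Levels.
Context {R : realType} {d : nat}.
Implicit Types (m : nat -> 'I_d -> nat) (B : nat -> seq 'rV[int]_d) (xi : 'rV[R]_d).

(** The diagonal of the product of the first n matrices; [Pmat] at n has n + 1 factors, hence the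
    [n.+1] in [PmatE]. *)
Definition pp m n (i : 'I_d) : nat := \prod_(k < n) m k i.

Lemma pp_gt0 m n i : (forall k i, (0 < m k i)%N) -> (0 < pp m n i)%N.
Proof. by move=> m0; rewrite prodn_gt0. Qed.

Lemma ppS m n i : pp m n.+1 i = (pp m n i * m n i)%N.
Proof. by rewrite /pp big_ord_recr. Qed.

Lemma ppD m n k i : pp m (n + k) i = (pp m n i * pp (fun j => m (n + j)%N) k i)%N.
Proof. by rewrite /pp big_split_ord. Qed.

Lemma PmatE m n : Pmat R m n = diagR R (pp m n.+1).
Proof.
elim: n => [|n IH] /=.
  by congr diag_mx; apply/rowP => i; rewrite !mxE /pp big_ord1.
rewrite IH /diagR mulmx_diag; congr diag_mx.
by apply/rowP => i; rewrite !mxE [in RHS]ppS mulnC natrM.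
Qed.

Lemma factor_ptsE m B n : (forall k i, (0 < m k i)%N) ->
  factor_pts R m B n = [seq scl (pp m n.+1) (vecZ R b) | b <- B n].
Proof.
move=> m0; apply: eq_map => b; rewrite PmatE mxapp_invmx_diagR// => i.
exact: pp_gt0.
Qed.

(* Squared modulus of the Fourier transform of the n-th finite convolution. *)
Definition Fn m B n xi : R := \prod_(k < n) pw (factor_pts R m B k) xi.

Lemma FnE m B n xi :
  Fn m B n xi = mu_n_int m B n (ecos xi) ^+ 2 + mu_n_int m B n (esin xi) ^+ 2.
Proof.
by rewrite /mu_n_int conv_avg_pw big_map -[n in iota _ n]subn0 -/(index_iota _ _) big_mkord.
Qed.

Lemma Fn_ge0 m B n xi : 0 <= Fn m B n xi.
Proof. by apply: prodr_ge0 => k _; exact: pw_ge0. Qed.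

Lemma FnS m B n xi : Fn m B n.+1 xi = Fn m B n xi * pw (factor_pts R m B n) xi.
Proof. by rewrite /Fn big_ord_recr. Qed.

Lemma FnS_le m B n xi : Fn m B n.+1 xi <= Fn m B n xi.
Proof. by rewrite FnS ler_piMr ?Fn_ge0 ?pw_le1. Qed.

Lemma Fn_le m B n n' xi : (n <= n')%N -> Fn m B n' xi <= Fn m B n xi.
Proof.
move=> /subnK <-; elim: (n' - n)%N => // k IH.
by rewrite addSn (le_trans (FnS_le _ _ _ _)).
Qed.

Lemma Fn_le1 m B n xi : Fn m B n xi <= 1.
Proof. by rewrite (le_trans (Fn_le _ _ _ _ _ (leq0n n)))// /Fn big_ord0. Qed.

Lemma scl_scl (p q : 'I_d -> nat) (x : 'rV[R]_d) :
  scl p (scl q x) = scl (fun i => (q i * p i)%N) x.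
Proof. by apply/rowP => i; rewrite !mxE natrM invfM mulrA. Qed.

(** At level n + k the frequency xi acts on the digits as [scl (pp m n) xi] does at level k of the
    shifted sequence, so the second factor belongs to a tail. *)
Lemma FnD m B n N xi : (forall k i, (0 < m k i)%N) ->
  Fn m B (n + N) xi = Fn m B n xi *
    Fn (fun k => m (n + k)%N) (fun k => B (n + k)%N) N (scl (pp m n) xi).
Proof.
move=> m0; rewrite /Fn big_split_ord /=; congr (_ * _).
apply: eq_bigr => k _; rewrite !factor_ptsE//.
have E b : dotp xi (scl (pp m (n + k).+1) (vecZ R b)) =
    dotp (scl (pp m n) xi) (scl (pp (fun k0 => m (n + k0)%N) k.+1) (vecZ R b)).
  rewrite -dotp_scl scl_scl; congr dotp.
  by apply/rowP => i; rewrite !mxE -addnS ppD mulnC.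
rewrite /pw /avg !size_map !big_map.
by congr ((_ * _) ^+ 2 + (_ * _) ^+ 2); apply: eq_bigr => b _; rewrite /ecos /esin E.
Qed.

Definition mulZ (p : 'I_d -> nat) (z : 'rV[int]_d) : 'rV[int]_d :=
  \row_i ((p i)%:Z * z 0 i).

Lemma scl_mulZ (p : 'I_d -> nat) (z : 'rV[int]_d) : (forall i, (0 < p i)%N) ->
  scl p (vecZ R (mulZ p z)) = vecZ R z.
Proof.
move=> p0; apply/rowP => i; rewrite !mxE intrM mulrAC mulfV ?mul1r//.
by rewrite pnatr_eq0 -lt0n.
Qed.

(** Coordinates of points of the first n levels have denominators dividing [pp m n], so the shift
    pairs with these points to integers. *)
Lemma Fn_periodic m B n xi z : (forall k i, (0 < m k i)%N) ->
  Fn m B n (xi + vecZ R (mulZ (pp m n) z)) = Fn m B n xi.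
Proof.
move=> m0; apply: eq_bigr => k _; apply: pwD_int => a.
rewrite factor_ptsE// => /mapP[b _ ->]; rewrite dotp_scl; apply: rpred_sum => i _.
rewrite !mxE.
have -> : pp m n i = pp m (k.+1 + (n - k.+1)) i by rewrite subnKC.
rewrite ppD.
set p := pp m k.+1 i; set q := pp _ _ i.
have p0 : p%:R != 0 :> R by rewrite pnatr_eq0 -lt0n pp_gt0.
rewrite (_ : _ / _ * _ = (q%:Z * z 0 i * b 0 i)%:~R) ?intr_int//.
by rewrite PoszM !intrM; field.
Qed.

End Levels.

(** * Mixed-radix expansions *)

Section MixedRadix.
Context {R : realType}.
Variable m : nat -> nat.
Hypothesis m_ge2 : forall k, (2 <= m k)%N.

Definition mrad n : R := (\prod_(k < n) m k)%N%:R.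

Definition mixed (b : nat -> int) n : R := \sum_(0 <= k < n) (b k)%:~R / mrad k.+1.

Lemma mixedB b s n : (s <= n)%N ->
  mixed b n - mixed b s = \sum_(s <= k < n) (b k)%:~R / mrad k.+1.
Proof. by move=> sn; rewrite /mixed (big_cat_nat _ sn)//= addrAC subrr add0r. Qed.

Lemma mradS n : mrad n.+1 = mrad n * (m n)%:R.
Proof. by rewrite /mrad big_ord_recr /= natrM. Qed.

Lemma mrad_gt0 n : 0 < mrad n.
Proof. by rewrite ltr0n prodn_gt0// => k; rewrite (leq_trans _ (m_ge2 k)). Qed.

Lemma mrad0 : mrad 0 = 1.
Proof. by rewrite /mrad big_ord0. Qed.

Lemma mrad_ge n : 2 ^+ n <= mrad n.
Proof.
elim: n => [|n IH]; first by rewrite mrad0 expr0.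
rewrite mradS exprSr ler_pM// ?exprn_ge0//.
by rewrite ler_nat.
Qed.

Lemma mrad_le n n' : (n <= n')%N -> mrad n <= mrad n'.
Proof.
move=> /subnK <-; elim: (n' - n)%N => // k IH.
rewrite addSn mradS (le_trans IH)// ler_peMr ?(ltW (mrad_gt0 _))//.
by rewrite ler1n (leq_trans _ (m_ge2 _)).
Qed.

Lemma mrad_le_expn M n : (forall k, (m k <= M)%N) -> mrad n <= (M ^ n)%:R.
Proof.
move=> mM; rewrite /mrad ler_nat -[X in (_ <= _ ^ X)%N]card_ord -prod_nat_const.
exact: leq_prod.
Qed.

(** The largest digit, m_k - 1, contributes exactly 1 / [mrad k] - 1 / [mrad k.+1], which
    telescopes; [c] measures the distance to it. *)
Lemma digit_le b k (c : int) : b k <= (m k)%:Z - 1 - c ->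
  (b k)%:~R / mrad k.+1 <= (mrad k)^-1 - (mrad k.+1)^-1 - c%:~R / mrad k.+1.
Proof.
move=> H; have r0 := mrad_gt0 k; have r1 := mrad_gt0 k.+1.
have -> : (mrad k)^-1 = (m k)%:R / mrad k.+1.
  rewrite mradS invfM mulrCA mulfV ?mulr1// pnatr_eq0.
  by rewrite -lt0n (leq_trans _ (m_ge2 k)).
rewrite -[X in _ - X - _]mul1r -!mulrBl ler_pM2r ?invr_gt0//.
by move: H; rewrite -(ler_int R) !intrD !rmorphN.
Qed.

Lemma sum_mrad s n : (s <= n)%N ->
  \sum_(s <= k < n) ((mrad k)^-1 - (mrad k.+1)^-1) = (mrad s)^-1 - (mrad n)^-1.
Proof.
move=> sn; rewrite (telescope_sumr_eq (fun k => - (mrad k)^-1))//.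
  by rewrite opprK addrC.
by move=> k _; rewrite opprK addrC.
Qed.

Variable b : nat -> int.

Lemma mixed_tail s n : (s <= n)%N ->
  (forall k, (s <= k < n)%N -> 0 <= b k < (m k)%:Z) ->
  0 <= mixed b n - mixed b s <= (mrad s)^-1.
Proof.
move=> sn Hb.
rewrite mixedB//; apply/andP; split.
  rewrite big_nat; apply: sumr_ge0 => k /Hb/andP[b0 _].
  by rewrite divr_ge0 ?ler0z ?(ltW (mrad_gt0 _)).
apply: (@le_trans _ _ (\sum_(s <= k < n) ((mrad k)^-1 - (mrad k.+1)^-1))).
  rewrite !big_nat; apply: ler_sum => k /Hb/andP[_ b1].
  have := @digit_le b k 0; rewrite mul0r !subr0; apply; lia.
by rewrite sum_mrad// lerBlDr lerDl invr_ge0 (ltW (mrad_gt0 _)).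
Qed.

Lemma mixed_bounds n : (forall k, (k < n)%N -> 0 <= b k < (m k)%:Z) ->
  0 <= mixed b n <= 1.
Proof.
move=> Hb; have := @mixed_tail 0 n (leq0n _).
have -> : mixed b 0 = 0 by rewrite /mixed big_geq.
by rewrite subr0 mrad0 invr1; apply=> k /andP[_ /Hb].
Qed.

(** One nonzero digit keeps a point away from the face 0; symmetrically, in [mixed_le] one
    non-maximal digit keeps it away from the face 1. These margins exclude wrap-around. *)
Lemma mixed_ge n j : (forall k, (k < n)%N -> 0 <= b k < (m k)%:Z) -> (j < n)%N ->
  1 <= b j -> (mrad j.+1)^-1 <= mixed b n.
Proof.
move=> Hb jn bj; have := mixed_tail _ _ jn.
have -> : mixed b j.+1 = mixed b j + (b j)%:~R / mrad j.+1.
  by rewrite /mixed big_nat_recr.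
have /andP[H0 _] : 0 <= mixed b j <= 1.
  by apply: mixed_bounds => k kj; apply: Hb; exact: ltn_trans jn.
case/(_ _)/andP; first by move=> k /andP[_ /Hb].
move=> H1 _.
have : (mrad j.+1)^-1 <= (b j)%:~R / mrad j.+1.
  by rewrite ler_peMl ?ler1z// invr_ge0 ltW// mrad_gt0.
lra.
Qed.

Lemma mixed_le n j : (forall k, (k < n)%N -> 0 <= b k < (m k)%:Z) -> (j < n)%N ->
  b j <= (m j)%:Z - 2 -> mixed b n <= 1 - (mrad j.+1)^-1.
Proof.
move=> Hb jn bj; have := mixed_tail _ _ jn.
have -> : mixed b j.+1 = mixed b j + (b j)%:~R / mrad j.+1.
  by rewrite /mixed big_nat_recr.
have H0 : mixed b j <= 1 - (mrad j)^-1.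
  have := sum_mrad 0 j (leq0n _); rewrite mrad0 invr1 => <-.
  rewrite /mixed !big_nat; apply: ler_sum => k.
  move=> /andP[_ kj]; have := Hb k (ltn_trans kj jn) => /andP[_ bk].
  have := @digit_le b k 0; rewrite mul0r !subr0; apply; lia.
case/(_ _)/andP; first by move=> k /andP[_ /Hb].
move=> _ H1.
have : (b j)%:~R / mrad j.+1 <= (mrad j)^-1 - (mrad j.+1)^-1 - 1%:~R / mrad j.+1.
  by apply: digit_le; lia.
rewrite mul1r; lra.
Qed.

End MixedRadix.

(** * Digit sequences and the base point *)

Section Digits.
Context {R : realType} {d : nat}.
Variables (m : nat -> 'I_d -> nat) (B : nat -> seq 'rV[int]_d).
Hypothesis mB : forall n, in_Dd (m n) (B n).

Lemma in_Dd_ge2 n i : (2 <= m n i)%N. Proof. by have [/(_ i)] := mB n. Qed.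

Lemma in_Dd_gt0 n i : (0 < m n i)%N.
Proof. by rewrite (leq_trans _ (in_Dd_ge2 n i)). Qed.

Lemma in_Dd_nil n : B n != [::]. Proof. by have [_ [_ []]] := mB n. Qed.

Lemma in_Dd_digit n b i : b \in B n -> 0 <= b 0 i < (m n i)%:Z.
Proof. by have [_ [_ [_ H]]] := mB n; move=> /H/(_ i)[-> ->]. Qed.

(** Truncations are subtracted because the support may begin at any level [s]; [mixed_tail] bounds
    such differences. *)
Lemma pts_levels s n (x : 'rV[R]_d) :
  pts [seq factor_pts R m B k | k <- iota s n] x ->
  exists2 beta : nat -> 'rV[int]_d,
    forall k, (s <= k < s + n)%N -> beta k \in B k &
    forall i, x 0 i = mixed (m ^~ i) (fun k => beta k 0 i) (s + n)
                      - mixed (m ^~ i) (fun k => beta k 0 i) s.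
Proof.
elim: n s x => [|n IH] s x /=.
  move=> ->; exists (fun k => 0); first by move=> k; lia.
  by move=> i; rewrite addn0 subrr mxE.
move=> [a [y [aB /IH[beta Hb Hy] ->]]].
move: aB; rewrite factor_ptsE; last exact: in_Dd_gt0.
case/mapP => b bB ->.
exists (fun k => if k == s then b else beta k).
  move=> k; case: eqP => [->//|ks] Hk; apply: Hb; lia.
move=> i; rewrite !mxE Hy !mixedB ?leq_addr// addSnnS.
rewrite [RHS]big_ltn ?eqxx; last lia.
congr (_ + _).
rewrite !big_nat; apply: eq_bigr => k /andP[ks _].
by rewrite gtn_eqF.
Qed.

Definition ptof (al : nat -> 'rV[int]_d) n : 'rV[R]_d :=
  \row_i mixed (m ^~ i) (fun k => al k 0 i) n.

Lemma ptofE al n :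
  \sum_(a <- [seq scl (pp m k.+1) (vecZ R (al k)) | k <- iota 0 n]) a = ptof al n.
Proof.
apply/rowP => i; rewrite summxE big_map !mxE /mixed /index_iota subn0.
by apply: eq_bigr => k _; rewrite !mxE.
Qed.

Lemma Fn_at0 n : Fn m B n (0 : 'rV[R]_d) = 1.
Proof.
rewrite /Fn big1// => j _; apply: pw0.
by rewrite -size_eq0 size_map size_eq0 in_Dd_nil.
Qed.

Variable M : nat.
Hypothesis mM : forall n i, (m n i <= M)%N.

Lemma size_digits n : (size (B n) <= M ^ d)%N.
Proof.
have [m2 [uB [_ HB]]] := mB n.
have [->|B0] := eqVneq (B n) [::]; first by [].
(* The default of [insubd] is the ordinal 0; it is never reached, digits being below [M]. *)
pose f (b : 'rV[int]_d) : {ffun 'I_d -> 'I_M} := [ffun i => insubd (Ordinal (leq_trans (in_Dd_gt0 n i) (mM n i))) `|b 0%R i|%N].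
have inj : {in B n &, injective f}.
  move=> b c bB cB /ffunP E; apply/rowP => i; move: (E i); rewrite !ffunE.
  have /andP[b0 b1] := in_Dd_digit _ _ i bB; have /andP[c0 c1] := in_Dd_digit _ _ i cB.
  have := mM n i => mMi.
  move=> /(congr1 val); rewrite !val_insubd !ifT.
  - by move=> E'; rewrite -(gez0_abs b0) -(gez0_abs c0) E'.
  - by rewrite -ltz_nat gez0_abs// (lt_le_trans c1).
  - by rewrite -ltz_nat gez0_abs// (lt_le_trans b1).
rewrite -(size_map f) -[X in (_ <= X ^ _)%N]card_ord -[X in (_ <= _ ^ X)%N](card_ord d).
by rewrite -card_ffun -(card_uniqP _) ?max_card// map_inj_in_uniq.
Qed.

(* For the i-th coordinate the digits of levels 2i and 2i+1 are used: either one
   of these levels keeps the whole support away from one of the two faces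
   x_i = 0 and x_i = 1, or the base point can be kept away from both. *)
Lemma base_digits : exists2 al : nat -> 'rV[int]_d, forall k, al k \in B k &
  forall (K n : nat) (be : nat -> 'rV[int]_d) i, (d.*2 <= K)%N -> (d.*2 <= n)%N ->
    (forall k, (k < n)%N -> be k \in B k) ->
    `|ptof be n 0 i - ptof al K 0 i| <= 1 - ((M ^ d.*2)%:R)^-1.
Proof.
(* For coordinate i the base point takes digit 0 at level 2i and the maximal digit at level 2i + 1,
   whenever these are available. Each level serves one coordinate only, so the demands never
   conflict. *)
pose Q k (b : 'rV[int]_d) := forall i : 'I_d,
  (k = i.*2 -> (exists2 b', b' \in B k & b' 0 i = 0) -> b 0 i = 0) /\
  (k = i.*2.+1 -> (exists2 b', b' \in B k & b' 0 i = (m k i)%:Z - 1) ->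
     b 0 i = (m k i)%:Z - 1).
have /choice[al Hal] : forall k, exists b, b \in B k /\ Q k b.
  move=> k; have [b0 b0B] : exists b, b \in B k.
    by move: (in_Dd_nil k); case: (B k) => // b s _; exists b; rewrite inE eqxx.
  have [kd|kd] := ltnP k./2 d; last by exists b0; split=> // i; split; have := ltn_ord i; lia.
  pose i := Ordinal kd.
  pose E b' := b' \in B k /\ if odd k then b' 0 i = (m k i)%:Z - 1 else b' 0 i = 0.
  have [[b' [b'B b'E]]|nE] := pselect (exists b', E b').
    exists b'; split=> // j; split=> kj _.
      have -> : j = i by apply: val_inj; rewrite /= kj doubleK.
      by move: b'E; rewrite kj odd_double.
    have -> : j = i by apply: val_inj; rewrite /= kj; lia.
    by move: b'E; rewrite {1}kj /= odd_double.
  exists b0; split=> // j; split=> kj [b' b'B b'E]; exfalso; apply: nE; exists b'.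
    split=> //; have <- : j = i by apply: val_inj; rewrite /= kj doubleK.
    by rewrite {1}kj odd_double.
  split=> //; have <- : j = i by apply: val_inj; rewrite /= kj; lia.
  by rewrite {1}kj /= odd_double.
exists al => [k|K n be i dK dn Hbe]; first by have [] := Hal k.
have alB k : al k \in B k by have [] := Hal k.
have id2 := ltn_ord i.
set r := _^-1.
have m2 k : (2 <= m k i)%N by exact: in_Dd_ge2.
(* Levels below 2d have scale at most M^(2d), so one margin r fits them all. *)
have rP j : (j < d.*2)%N -> r <= (@mrad R (m ^~ i) j.+1)^-1.
  move=> jd; rewrite lef_pV2 ?posrE ?mrad_gt0//; last first.
    by rewrite ltr0n expn_gt0 (leq_trans (in_Dd_gt0 0%N i) (mM 0%N i)).
  apply: le_trans (mrad_le_expn (m ^~ i) M _ (fun k => mM k i)).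
  exact: mrad_le.
have bD k : (k < n)%N -> 0 <= be k 0 i < (m k i)%:Z by move=> /Hbe; exact: in_Dd_digit.
have aD k : (k < K)%N -> 0 <= al k 0 i < (m k i)%:Z by move=> _; exact: in_Dd_digit.
rewrite !mxE.
have /andP[b0 b1] := @mixed_bounds R _ m2 _ _ bD.
have /andP[a0 a1] := @mixed_bounds R _ m2 _ _ aD.
(* If no digit 0 occurs at level 2i, both points have i-th coordinate at least r. *)
have [E0|nE0] := pselect (exists2 b', b' \in B i.*2 & b' 0 i = 0); last first.
  have D b : b \in B i.*2 -> 1 <= b 0 i.
    move=> bB; have /andP[c0 _] := in_Dd_digit _ _ i bB.
    have : b 0 i <> 0 by move=> c; apply: nE0; exists b.
    lia.
  have ij : (i.*2 < d.*2)%N by lia.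
  have := rP _ ij.
  have := @mixed_ge R _ m2 _ _ _ bD (leq_trans ij dn) (D _ (Hbe _ (leq_trans ij dn))).
  have := @mixed_ge R _ m2 _ _ _ aD (leq_trans ij dK) (D _ (alB _)).
  rewrite ler_norml; lra.
(* If no maximal digit occurs at level 2i + 1, both coordinates are at most 1 - r. *)
have [E1|nE1] := pselect (exists2 b', b' \in B i.*2.+1 & b' 0 i = (m i.*2.+1 i)%:Z - 1); last first.
  have D b : b \in B i.*2.+1 -> b 0 i <= (m i.*2.+1 i)%:Z - 2.
    move=> bB; have /andP[_ c0] := in_Dd_digit _ _ i bB.
    have : b 0 i <> (m i.*2.+1 i)%:Z - 1 by move=> c; apply: nE1; exists b.
    lia.
  have ij : (i.*2.+1 < d.*2)%N by lia.
  have := rP _ ij.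
  have := @mixed_le R _ m2 _ _ _ bD (leq_trans ij dn) (D _ (Hbe _ (leq_trans ij dn))).
  have := @mixed_le R _ m2 _ _ _ aD (leq_trans ij dK) (D _ (alB _)).
  rewrite ler_norml; lra.
(* Both digits occur and the base point uses them: its coordinate lies in [r, 1 - r], wherever the
   other point is. *)
have [_ /(_ i)[/(_ erefl E0) A0 _]] := Hal i.*2.
have [_ /(_ i)[_ /(_ erefl E1) A1]] := Hal i.*2.+1.
have ij0 : (i.*2 < d.*2)%N by lia.
have ij1 : (i.*2.+1 < d.*2)%N by lia.
have := rP _ ij0; have := rP _ ij1.
have := @mixed_ge R _ m2 _ _ _ aD (leq_trans ij1 dK).
rewrite A1 => /(_ _)H1; have := m2 i.*2.+1 => mm; have {}H1 := H1 ltac:(lia).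
have := @mixed_le R _ m2 _ _ _ aD (leq_trans ij0 dK).
rewrite A0 => /(_ _)H2; have := m2 i.*2 => mm'; have {}H2 := H2 ltac:(lia).
rewrite ler_norml; lra.
Qed.

End Digits.

(** * A periodic cosine bump *)

Section CosBump.
Context {R : realType}.
Implicit Types t r : R.

(** This is cos^2(pi t), equal to 1 exactly at the integers, with Fourier coefficients 1/2, 1/4,
    1/4. *)
Definition cosb t : R := (1 + cos (2 * pi * t)) / 2.

Lemma cosb_ge0 t : 0 <= cosb t.
Proof. have := cos_geN1 (2 * pi * t); rewrite /cosb; lra. Qed.

Lemma cosb_le1 t : cosb t <= 1.
Proof. have := cos_le1 (2 * pi * t); rewrite /cosb; lra. Qed.

Lemma cosbN t : cosb (- t) = cosb t.
Proof. by rewrite /cosb mulrN cosN. Qed.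

Lemma pi_lt4 : pi < 4 :> R.
Proof. have := @pihalf_lt2 R; lra. Qed.

Lemma cosb_norm t : cosb `|t| = cosb t.
Proof. by case: (ler0P t) => // _; rewrite cosbN. Qed.

Lemma cosb_lt1 t : 0 < t < 1 -> cosb t < 1.
Proof.
have pi0 := @pi_gt0 R.
wlog : t / t <= 2^-1 => [H /andP[t0 t1]|th /andP[t0 t1]].
  have [th|th] := leP t 2^-1; first by apply: H => //; apply/andP.
  have -> : cosb t = cosb (1 - t).
    rewrite /cosb (_ : 2 * pi * (1 - t) = - (2 * pi * t) + 2 * pi * 1%:~R); last by ring.
    by rewrite cosDint cosN.
  by apply: H; [lra|apply/andP; split; lra].
have : cos (2 * pi * t) < cos 0 :> R.
  rewrite ltr_cos ?in_itv /=.
  - by nra.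
  - by apply/andP; split; nra.
  - by apply/andP; split; nra.
by rewrite cos0 /cosb; lra.
Qed.

Lemma cosb_le r t : 0 < r -> r <= `|t| <= 1 - r -> cosb t <= cosb r.
Proof.
have pi0 := @pi_gt0 R.
move=> r0; rewrite -cosb_norm; move: `|t| => {}t.
wlog : t / t <= 2^-1 => [H /andP[t0 t1]|th /andP[t0 t1]].
  have [th|th] := leP t 2^-1; first by apply: H => //; apply/andP.
  have -> : cosb t = cosb (1 - t).
    rewrite /cosb (_ : 2 * pi * (1 - t) = - (2 * pi * t) + 2 * pi * 1%:~R); last by ring.
    by rewrite cosDint cosN.
  by apply: H; [lra|apply/andP; split; lra].
have [->//|rt] := eqVneq r t.
have {}t0 : r < t by rewrite lt_neqAle rt.
have : cos (2 * pi * t) < cos (2 * pi * r) :> R.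
  rewrite ltr_cos ?in_itv /=.
  - by nra.
  - by apply/andP; split; nra.
  - by apply/andP; split; nra.
by rewrite /cosb; lra.
Qed.

Lemma cos_ge1B t : 1 - `|t| <= cos t.
Proof.
have := cos_dist 0 t; rewrite cos0 sub0r normrN => /ler_normlP[_]; lra.
Qed.

Lemma cosb_ge t : 1 - 4 * `|t| <= cosb t.
Proof.
have := cos_ge1B (2 * pi * t); rewrite /cosb !normrM.
rewrite (ger0_norm (@pi_ge0 R)) (ger0_norm (ler0n R 2)) => H.
have : pi * `|t| <= 4 * `|t| by rewrite ler_wpM2r// ltW// pi_lt4.
lra.
Qed.

End CosBump.

(** * Testing against products of bumps *)

Section TestFunction.
Context {R : realType} {d : nat}.
Variables (m : nat -> 'I_d -> nat) (B : nat -> seq 'rV[int]_d).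
Implicit Types (a x xi : 'rV[R]_d) (cs : seq 'I_d).

(** Coordinates come from a list with repetitions: powers arise by repeating it, the Fourier
    expansion by induction on it. *)
Definition tst cs a x : R := \prod_(i <- cs) cosb (x 0 i - a 0 i).

Definition unitv (i : 'I_d) : 'rV[int]_d := delta_mx 0 i.

Lemma ecos_unitv i x : ecos (vecZ R (unitv i)) x = cos (2 * pi * x 0 i).
Proof.
rewrite /ecos /dotp (bigD1 i)//= !mxE !eqxx mul1r big1 ?addr0// => j ji.
by rewrite !mxE (negPf ji) andbF mul0r.
Qed.

(** A bump factor splits the frequency xi into xi and its two shifts by a unit vector, with weights
    1/2, 1/4, 1/4. *)
Lemma tst_cons i cs a xi x : tst (i :: cs) a x * ecos xi (x - a) =
  2^-1 * (tst cs a x * ecos xi (x - a)) +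
  (4^-1 * (tst cs a x * ecos (xi + vecZ R (unitv i)) (x - a)) +
   4^-1 * (tst cs a x * ecos (xi + vecZ R (- unitv i)) (x - a))).
Proof.
rewrite /tst big_cons vecZN ecosDl ecosBl ecos_unitv /cosb !mxE; lra.
Qed.

(* The Fourier coefficients of the nonnegative trigonometric polynomial [tst cs a]
   sum to 1, hence testing against it cannot exceed the largest Fourier coefficient. *)
Lemma tst_upper cs a (e : R) xi : 0 < e ->
  (forall k : 'rV[int]_d, exists N, Fn m B N (xi + vecZ R k) < e ^+ 2) ->
  exists N0, forall N, (N0 <= N)%N ->
    `|mu_n_int m B N (fun x => tst cs a x * ecos xi (x - a))| <= e.
Proof.
move=> e0; elim: cs xi => [|i cs IH] xi H.
  have [N0] := H 0; rewrite vecZ0 addr0 => H0.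
  exists N0 => N /(Fn_le m B _ _ xi) HN.
  have {HN} : Fn m B N xi <= e ^+ 2 by rewrite (le_trans HN)// ltW.
  rewrite FnE; set C := mu_n_int m B N (ecos xi); set S := mu_n_int m B N (esin xi).
  have -> : mu_n_int m B N (fun x => tst [::] a x * ecos xi (x - a)) =
      ecos xi a * C + esin xi a * S.
    rewrite /C /S /mu_n_int -!conv_avgZ -conv_avgD; apply: eq_conv_avg => x.
    by rewrite /tst big_nil mul1r ecosB mulrC (mulrC (esin xi a)).
  move=> H2; rewrite -(@ler_pXn2r _ 2)// ?nnegrE ?(ltW e0)//.
  rewrite real_normK ?num_real// (le_trans _ H2)//.
  have := cos2Dsin2 (2 * pi * dotp xi a); rewrite -/(ecos xi a) -/(esin xi a).
  (* Lagrange's identity: adding this square to the left side gives (c^2 + s^2)(C^2 + S^2). *)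
  have := sqr_ge0 (ecos xi a * S - esin xi a * C).
  set c := ecos _ _; set s := esin _ _ => H3 H4.
  have -> : C ^+ 2 + S ^+ 2 = (c ^+ 2 + s ^+ 2) * (C ^+ 2 + S ^+ 2) by rewrite H4 mul1r.
  nra.
have H' (k : 'rV[int]_d) : forall k', exists N, Fn m B N (xi + vecZ R k + vecZ R k') < e ^+ 2.
  by move=> k'; have := H (k + k'); rewrite vecZD addrA.
have [N0 H0] := IH _ H.
have [N1 H1] := IH _ (H' (unitv i)).
have [N2 H2] := IH _ (H' (- unitv i)).
exists (maxn N0 (maxn N1 N2)) => N; rewrite !geq_max => /andP[/H0 {}H0 /andP[/H1 {}H1 /H2 {}H2]].
rewrite /mu_n_int (eq_conv_avg _ _ _ (tst_cons i cs a xi)) !conv_avgD !conv_avgZ.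
rewrite -!/(mu_n_int _ _ _ _).
move: H0 H1 H2; rewrite !ler_norml; lra.
Qed.

Hypothesis mB : forall n, in_Dd (m n) (B n).
Variable M : nat.
Hypothesis M0 : (0 < M)%N.
Hypothesis mM : forall n i, (m n i <= M)%N.

Lemma tst_flatten s a x : tst (flatten (nseq s (enum 'I_d))) a x =
  (\prod_(i < d) cosb (x 0 i - a 0 i)) ^+ s.
Proof.
elim: s => [|s IH]; first by rewrite /tst big_nil expr0.
by rewrite /tst /= big_cat /= -!/(tst _ _ _) IH exprS /tst big_enum.
Qed.

Lemma level_nil s n : all (fun A => A != [::]) [seq factor_pts R m B k | k <- iota s n].
Proof.
apply/allP => A /mapP[k _ ->].
by rewrite -size_eq0 size_map size_eq0 (in_Dd_nil _ _ mB).
Qed.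

(** On the cylinder of the first [K] digits of [a], of mass at least M^(-dK), the integrand is at
    least theta^s / 2. Elsewhere on the support it can be negative only far from [a], where the
    margin of [base_digits] bounds the bump by [cosb r]. *)
Lemma tst_lower (K s : nat) (r theta : R) :
  (d.*2 <= K)%N -> 0 < r <= ((M ^ d.*2)%:R)^-1 -> 8 * d%:R * r <= 2^-1 ->
  0 <= theta -> 2^-1 ^+ K <= r -> 4 * 2^-1 ^+ K <= 1 :> R -> theta <= (1 - 4 * 2^-1 ^+ K) ^+ d ->
  exists a, forall xi N, (forall i, `|xi 0 i| <= 1) -> (K <= N)%N ->
   (((M ^ d) ^ K)%:R)^-1 * (theta ^+ s / 2) - cosb r ^+ s <=
    mu_n_int m B N
      (fun x => tst (flatten (nseq s (enum 'I_d))) a x * ecos xi (x - a)).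
Proof.
move=> dK /andP[r0 rM] dr th0 Kr K1 thK.
have [al alB Hal] := @base_digits R _ _ _ mB M mM.
pose a : 'rV[R]_d := ptof m al K; exists a => xi N xi1 KN.
set g := fun x => _.
pose h x := \prod_(i < d) cosb (x 0 i - a 0 i).
have h0 x : 0 <= h x by apply: prodr_ge0 => i _; exact: cosb_ge0.
have h1 x : h x <= 1 by apply: prodr_ile1 => i _; rewrite cosb_ge0 cosb_le1.
have gE x : g x = h x ^+ s * ecos xi (x - a) by rewrite /g tst_flatten.
(* Since pi < 4, the phase is at most 8 d r <= 1/2. *)
have near_a x : (forall i, `|x 0 i - a 0 i| <= r) -> 2^-1 <= ecos xi (x - a).
  move=> xa; have := cos_ge1B (2 * pi * dotp xi (x - a)); rewrite -/(ecos _ _).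
  suff : `|2 * pi * dotp xi (x - a)| <= 8 * d%:R * r by lra.
  rewrite !normrM (ger0_norm (@pi_ge0 R)) (ger0_norm (ler0n R 2)) -mulrA.
  have -> : 8 * d%:R * r = 2 * 4 * (d%:R * r) :> R by ring.
  rewrite -[leRHS]mulrA ler_pM2l// ler_pM ?pi_ge0 ?(ltW pi_lt4)//.
  have -> : d%:R * r = \sum_(i < d) r by rewrite sumr_const card_ord mulr_natl.
  rewrite /dotp (le_trans (ler_norm_sum _ _ _))//; apply: ler_sum => i _.
  rewrite normrM -[leRHS]mul1r ler_pM//.
  by rewrite (_ : (x - a) 0 i = x 0 i - a 0 i)// !mxE.
have dN := leq_trans dK KN.
have far_a x : pts [seq factor_pts R m B k | k <- iota 0 N] x -> - cosb r ^+ s <= g x.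
  move=> /(pts_levels _ _ mB)[be Hbe xE].
  have nowrap i : `|x 0 i - a 0 i| <= 1 - r.
    have := Hal K N be i dK dN Hbe; rewrite mxE -/a => Hi.
    rewrite xE add0n {2}/mixed big_geq// subr0 (le_trans Hi)//; lra.
  rewrite gE; have [near|] := pselect (forall i, `|x 0 i - a 0 i| <= r).
    apply: (@le_trans _ _ 0); first by rewrite oppr_le0 exprn_ge0// cosb_ge0.
    by rewrite mulr_ge0 ?exprn_ge0// (le_trans _ (near_a _ near)).
  move=> /existsNP[i /negP]; rewrite -ltNge => /ltW xi_far.
  have hr : h x <= cosb r.
    rewrite /h (bigD1 i)//= (@le_trans _ _ (cosb (x 0 i - a 0 i)))//.
      rewrite ler_piMr ?cosb_ge0//.
      by apply: prodr_ile1 => j _; rewrite cosb_ge0 cosb_le1.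
    by apply: cosb_le => //; rewrite xi_far nowrap.
  have : h x ^+ s <= cosb r ^+ s by rewrite lerXn2r// nnegrE ?cosb_ge0.
  have := exprn_ge0 s (h0 x); have := cos_geN1 (2 * pi * dotp xi (x - a)).
  rewrite -/(ecos _ _); nra.
pose As1 := [seq factor_pts R m B k | k <- iota 0 K].
pose As2 := [seq factor_pts R m B k | k <- iota K (N - K)].
have EN : [seq factor_pts R m B k | k <- iota 0 N] = As1 ++ As2.
  by rewrite -map_cat -iotaD subnKC.
(* The added constant makes the integrand nonnegative on the support, as the cylinder estimate
   requires; it is subtracted at the end. *)
have := @conv_avg_cylinder R d As1 As2
  [seq scl (pp m k.+1) (vecZ R (al k)) | k <- iota 0 K]
  (fun x => g x + cosb r ^+ s) (theta ^+ s / 2).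
have gt0 := in_Dd_gt0 _ _ mB.
rewrite ptofE !size_map; move/(_ erefl) => /(_ _ _ _ _)Hc.
have {}Hc : (\prod_(A <- As1) (size A)%:R)^-1 * (theta ^+ s / 2) <=
    conv_avg (As1 ++ As2) (fun x => g x + cosb r ^+ s).
  apply: Hc.
  - move=> k; rewrite size_iota => kK.
    rewrite !(nth_map 0%N) ?size_iota// !nth_iota// add0n factor_ptsE//.
    exact: (map_f (fun b => scl (pp m k.+1) (vecZ R b))).
  - by move=> x; rewrite -EN => /far_a; lra.
  - move=> y /(pts_levels _ _ mB)[be]; rewrite (subnKC KN) => Hbe yE.
    rewrite -/a.
    have Hy i : 0 <= (a + y) 0 i - a 0 i <= 2^-1 ^+ K.
      rewrite mxE addrAC subrr add0r yE.
      have m2 k : (2 <= m k i)%N by exact: in_Dd_ge2 mB _ _.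
      have [//||-> Hu] := andP (@mixed_tail R (m ^~ i) m2 (fun k => be k 0 i) K N _ _).
        by move=> k /Hbe; exact: in_Dd_digit.
      rewrite (le_trans Hu)// exprVn lef_pV2 ?posrE ?mrad_gt0 ?exprn_gt0//.
      exact: mrad_ge.
    have hth : theta <= h (a + y).
      rewrite (le_trans thK)// -[X in _ ^+ X]card_ord -prodr_const.
      apply: ler_prod => i _; rewrite subr_ge0 K1 /= (le_trans _ (cosb_ge _))//.
      by have /andP[y0 yK] := Hy i; rewrite ger0_norm//; lra.
    have near : 2^-1 <= ecos xi (a + y - a).
      apply: near_a => i; have /andP[y0 yK] := Hy i.
      by rewrite ger0_norm// (le_trans yK).
    have hs : theta ^+ s <= h (a + y) ^+ s by rewrite lerXn2r// nnegrE.
    have t0 := exprn_ge0 s th0.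
    have b0 := exprn_ge0 s (cosb_ge0 r).
    by rewrite gE; nra.
  - exact: level_nil.
rewrite lerBlDr /mu_n_int EN.
have -> : conv_avg (As1 ++ As2) g + cosb r ^+ s =
    conv_avg (As1 ++ As2) (fun x => g x + cosb r ^+ s).
  by rewrite conv_avgD conv_avg_cst// -EN level_nil.
apply: le_trans Hc; rewrite ler_wpM2r//.
  by rewrite mulr_ge0 ?exprn_ge0.
rewrite lef_pV2 ?posrE; last 2 first.
- by rewrite ltr0n !expn_gt0 M0.
- rewrite big_map big_seq; apply: prodr_gt0 => k _.
  by rewrite ltr0n size_map lt0n size_eq0 (in_Dd_nil _ _ mB).
rewrite big_map -natr_prod ler_nat -[X in (_ <= _ ^ X)%N]subn0 -prod_nat_const_nat /index_iota subn0.
by apply: leq_prod => k _; rewrite size_map (size_digits _ _ mB _ mM).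
Qed.

End TestFunction.

(** * Two elementary estimates for powers *)

Section RealFacts.
Context {R : realType}.

Lemma expr_small (q c : R) : 0 <= q < 1 -> 0 < c ->
  exists n0, forall n, (n0 <= n)%N -> q ^+ n <= c.
Proof.
move=> /andP[q0 q1] c0.
have /cvgrPdist_le/(_ c c0)[n0 _ H] := cvg_expr (ltac:(by rewrite ger0_norm) : `|q| < 1).
exists n0 => n /H /=; rewrite sub0r normrN ger0_norm ?exprn_ge0//.
Qed.

Lemma bernoulli_ineq (y : R) n : 0 <= y <= 1 -> 1 - n%:R * y <= (1 - y) ^+ n.
Proof.
move=> /andP[y0 y1]; elim: n => [|n IH]; first by rewrite mul0r subr0 expr0.
rewrite exprS -natr1.
have : (1 - y) * (1 - n%:R * y) <= (1 - y) * (1 - y) ^+ n by rewrite ler_wpM2l// subr_ge0.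
have : 0 <= n%:R * y ^+ 2 by rewrite mulr_ge0 ?sqr_ge0.
nra.
Qed.

End RealFacts.

(** * Equi-positivity *)

Section EquiPositive.
Context {R : realType} {d : nat}.

(** By contradiction: if at each integer translate of xi some [Fn] fell below (w th^s / 8)^2,
    [tst_upper] would bound the test integral by w th^s / 8, half of what [tst_lower] gives. *)
Lemma equipositive (M : nat) : (0 < M)%N -> exists2 e : R, 0 < e &
  forall (m : nat -> 'I_d -> nat) (B : nat -> seq 'rV[int]_d),
  (forall n, in_Dd (m n) (B n)) -> (forall n i, (m n i <= M)%N) ->
  forall xi : 'rV[R]_d, exists k, forall N, e <= Fn m B N (xi + vecZ R k).
Proof.
move=> M0; pose rho : R := ((M ^ d.*2)%:R)^-1.
have rho0 : 0 < rho by rewrite invr_gt0 ltr0n expn_gt0 M0.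
have rho1 : rho <= 1 by rewrite invf_le1 ?ler1n ?ltr0n expn_gt0 M0.
(* Using d + 1 instead of d keeps the divisions below meaningful for d = 0. *)
pose D : R := d.+1%:R.
have D1 : 1 <= D by rewrite ler1n.
have dD : d%:R + 1 = D :> R by rewrite natr1.
have d0 : 0 <= d%:R :> R by [].
(* Small enough both for the margin rho and for the phase bound 8 d r <= 1/2. *)
pose r := rho / (16 * D).
have rE : r * (16 * D) = rho by rewrite /r divfK// mulf_neq0//; lra.
have r0 : 0 < r by rewrite divr_gt0//; lra.
have rr : r * D >= r by rewrite ler_peMr// ltW.
pose ka := cosb r.
have ka1 : ka < 1 by apply: cosb_lt1; rewrite r0 /=; lra.
have ka0 : 0 <= ka by exact: cosb_ge0.
(* Midway between the bump at distance r and its maximum 1; [c] makes 4 d 2^-K <= 1 - th, so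
   Bernoulli's inequality bounds the product of bumps below by [th] on the cylinder. *)
pose th := (1 + ka) / 2.
pose c := (1 - ka) / (8 * D).
have cE : c * (8 * D) = 1 - ka by rewrite /c divfK// mulf_neq0//; lra.
have c0 : 0 < c by rewrite divr_gt0//; lra.
have cc : c * D >= c by rewrite ler_peMr// ltW.
have half : 0 <= (2^-1 : R) < 1 by apply/andP; split; lra.
have [K1 HK1] := expr_small _ _ half r0.
have [K2 HK2] := expr_small _ _ half c0.
pose K := maxn d.*2 (maxn K1 K2).
have Kr : (2^-1 : R) ^+ K <= r by apply: HK1; rewrite !leq_max leqnn !orbT.
have Kc : (2^-1 : R) ^+ K <= c by apply: HK2; rewrite !leq_max leqnn !orbT.
have pK0 : 0 < (2^-1 : R) ^+ K by rewrite exprn_gt0.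
have y01 : 0 <= 4 * (2^-1 : R) ^+ K <= 1 by apply/andP; split; lra.
pose w : R := (((M ^ d) ^ K)%:R)^-1.
have w0 : 0 < w by rewrite invr_gt0 ltr0n !expn_gt0 M0.
have th0 : 0 < th by rewrite /th; lra.
have kt : 0 <= ka / th < 1.
  apply/andP; split; first by rewrite divr_ge0// ltW.
  by rewrite ltr_pdivrMr// /th; lra.
have w4 : 0 < w / 4 by lra.
(* This power makes ka^s at most w th^s / 4, half of the cylinder's contribution. *)
have [s /(_ s (leqnn s)) Hs] := expr_small _ _ kt w4.
pose e := w / 4 * th ^+ s.
have e0 : 0 < e by rewrite mulr_gt0// exprn_gt0.
exists ((e / 2) ^+ 2); first by rewrite exprn_gt0//; lra.
move=> m B mB mM xi.
apply: contrapT => /forallNP H.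
pose z : 'rV[int]_d := \row_i Num.floor (xi 0 i).
pose xi0 := xi - vecZ R z.
have xi01 i : `|xi0 0 i| <= 1.
  have /andP[f1 f2] := floor_itv (xi 0 i).
  have E : xi0 0 i = xi 0 i - (Num.floor (xi 0 i))%:~R by rewrite !mxE.
  rewrite E ger0_norm; first by move: f2; rewrite intrD; lra.
  lra.
have [|||||||a Ha] := @tst_lower R d m B mB M M0 mM K s r th.
- exact: leq_maxl.
- by rewrite r0 /= -/rho; lra.
- have : d%:R * r <= D * r by rewrite ler_pM2r//; lra.
  lra.
- exact: ltW.
- exact: Kr.
- lra.
- apply: le_trans (bernoulli_ineq _ d y01).
  have : d%:R * (4 * (2^-1 : R) ^+ K) <= D * (4 * (2^-1 : R) ^+ K).
    by rewrite ler_pM2r//; lra.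
  have : D * (2^-1 : R) ^+ K <= D * c by rewrite ler_pM2l//; lra.
  rewrite /th; lra.
have [||N0 HN] := @tst_upper R d m B (flatten (nseq s (enum 'I_d))) a (e / 2) xi0.
- lra.
- move=> k; have /existsNP[N /negP] := H (k - z); rewrite -ltNge => HN.
  by exists N; rewrite /xi0 -addrA [- _ + _]addrC -vecZB.
have := Ha xi0 (maxn K N0) xi01 (leq_maxl _ _).
have := HN (maxn K N0) (leq_maxr _ _).
rewrite ler_norml => /andP[_ U] L.
have {U L} := le_trans L U; rewrite -/w -/ka.
have : ka ^+ s <= e.
  by rewrite /e -ler_pdivrMr ?exprn_gt0// -expr_div_n.
have : w * (th ^+ s / 2) = 2 * e by rewrite /e; field.
lra.
Qed.

(** All supports lie in the unit cube, so phases move by at most 2 pi d dl and the Lipschitz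
    constant does not depend on [N]. *)
Lemma Fn_dist (m : nat -> 'I_d -> nat) (B : nat -> seq 'rV[int]_d)
    N (xi y : 'rV[R]_d) (dl : R) :
  (forall n, in_Dd (m n) (B n)) -> (forall i, `|y 0 i| <= dl) ->
  `|Fn m B N (xi + y) - Fn m B N xi| <= 32 * d%:R * dl.
Proof.
move=> mB ydl.
have avg1 f : (forall x, `|f x| <= 1) -> `|mu_n_int m B N f| <= 1 :> R.
  move=> f1; rewrite (le_trans (norm_conv_avg _ _))//.
  rewrite -[leRHS](conv_avg_cst _ _ (level_nil _ _ mB 0 N)).
  by apply: ler_conv_avg.
have ang x : pts [seq factor_pts R m B k | k <- iota 0 N] x ->
    `|2 * pi * dotp (xi + y) x - 2 * pi * dotp xi x| <= 8 * d%:R * dl.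
  move=> /(pts_levels _ _ mB)[be Hbe xE].
  have x01 i : `|x 0 i| <= 1.
    rewrite xE add0n {2}/mixed big_geq// subr0.
    have m2 k : (2 <= m k i)%N by exact: in_Dd_ge2 mB _ _.
    have /andP[b0 b1] : 0 <= @mixed R (m ^~ i) (fun k => be k 0 i) N <= 1.
      by apply: mixed_bounds => // k /(Hbe k); exact: in_Dd_digit.
    by rewrite ger0_norm.
  rewrite -mulrBr dotpDl addrAC subrr add0r normrM normrM.
  rewrite (ger0_norm (@pi_ge0 R)) (ger0_norm (ler0n R 2)).
  have -> : 8 * d%:R * dl = 2 * 4 * (d%:R * dl) :> R by ring.
  rewrite ler_pM ?mulr_ge0 ?pi_ge0 ?ler_pM2l ?(ltW pi_lt4)//.
  have -> : d%:R * dl = \sum_(i < d) dl by rewrite sumr_const card_ord mulr_natl.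
  rewrite /dotp (le_trans (ler_norm_sum _ _ _))//; apply: ler_sum => i _.
  by rewrite normrM -[leRHS]mulr1 ler_pM.
have diff (f g : 'rV[R]_d -> R) :
    (forall x, pts [seq factor_pts R m B k | k <- iota 0 N] x -> `|f x - g x| <= 8 * d%:R * dl) ->
    (forall x, `|f x| <= 1) -> (forall x, `|g x| <= 1) ->
    `|mu_n_int m B N f ^+ 2 - mu_n_int m B N g ^+ 2| <= 16 * d%:R * dl.
  move=> fg f1 g1; rewrite subr_sqr normrM.
  have -> : 16 * d%:R * dl = (8 * d%:R * dl) * (1 + 1) by ring.
  apply: ler_pM => //; last first.
    by rewrite (le_trans (ler_normD _ _))// lerD// avg1.
  have -> : mu_n_int m B N f - mu_n_int m B N g = mu_n_int m B N (fun x => f x + -1 * g x).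
    by rewrite /mu_n_int conv_avgD conv_avgZ mulN1r.
  rewrite (le_trans (norm_conv_avg _ _))//.
  rewrite -[leRHS](conv_avg_cst _ _ (level_nil _ _ mB 0 N)).
  by apply: ler_conv_avg => x /fg; rewrite mulN1r.
rewrite !FnE.
have H1 := diff (ecos (xi + y)) (ecos xi)
  (fun x Hx => le_trans (cos_dist _ _) (ang x Hx)) (fun x => cos_max _) (fun x => cos_max _).
have H2 := diff (esin (xi + y)) (esin xi)
  (fun x Hx => le_trans (sin_dist _ _) (ang x Hx)) (fun x => sin_max _) (fun x => sin_max _).
move: H1 H2; rewrite !ler_norml; lra.
Qed.

(** A radius is needed because a fixed xi, divided by growing scales, is added later. Near 0 no
    translate is necessary, since the transform is 1 at 0. *)
Lemma equipositive_ball (M : nat) : (0 < M)%N -> exists e dl : R, [/\ 0 < e, 0 < dl &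
  forall (m : nat -> 'I_d -> nat) (B : nat -> seq 'rV[int]_d),
  (forall n, in_Dd (m n) (B n)) -> (forall n i, (m n i <= M)%N) ->
  (forall xi : 'rV[R]_d, exists k, forall N (y : 'rV[R]_d), (forall i, `|y 0 i| <= dl) ->
     e <= Fn m B N (xi + vecZ R k + y)) /\
  (forall N (y : 'rV[R]_d), (forall i, `|y 0 i| <= dl) -> e <= Fn m B N y)].
Proof.
move=> /equipositive[e e0 H]; pose dl := e / (64 * d.+1%:R).
have dl0 : 0 < dl by rewrite divr_gt0// mulr_gt0.
have dle : 32 * d%:R * dl <= e / 2.
  have : dl * (64 * d.+1%:R) = e by rewrite /dl divfK// mulf_neq0.
  have : 0 <= d%:R * dl by rewrite mulr_ge0// ltW.
  rewrite -natr1; lra.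
exists (e / 2), dl; split=> // [|m B mB mM]; first lra.
have P (xi y : 'rV[R]_d) N : e <= Fn m B N xi -> (forall i, `|y 0 i| <= dl) ->
    e / 2 <= Fn m B N (xi + y).
  move=> He /(Fn_dist m B N xi y dl mB); rewrite ler_norml; lra.
split=> [xi|N y Hy].
  by have [k Hk] := H m B mB mM xi; exists k => N y; apply: P.
rewrite -[y]add0r; apply: P => //.
have [k /(_ N) Hk] := H m B mB mM 0.
apply: le_trans Hk _; apply: (le_trans (Fn_le1 _ _ _ _)).
by rewrite (Fn_at0 _ _ mB).
Qed.

End EquiPositive.

(** * Spectra of finite convolutions and their limit *)

Section Tight.
Context {R : realType} {d : nat}.
Variables (m : nat -> 'I_d -> nat) (B : nat -> seq 'rV[int]_d).
Hypothesis mB : forall n, in_Dd (m n) (B n).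
Hypothesis admB : forall n, admissible (diagR R (m n)) (B n).
Implicit Types (L : seq 'rV[int]_d) (xi : 'rV[R]_d).

(* [L] is a spectrum of the n-th finite convolution. *)
Definition tight n L := forall xi, \sum_(l <- L) Fn m B n (xi + vecZ R l) = 1.

Let m0 : forall n i, (0 < m n i)%N := in_Dd_gt0 _ _ mB.

Lemma pw_factor n xi : pw (factor_pts R m B n) xi =
  pw [seq scl (m n) (vecZ R b) | b <- B n] (scl (pp m n) xi).
Proof.
rewrite factor_ptsE//.
have E b : dotp xi (scl (pp m n.+1) (vecZ R b)) =
    dotp (scl (pp m n) xi) (scl (m n) (vecZ R b)).
  rewrite -dotp_scl scl_scl; congr dotp.
  by apply/rowP => i; rewrite !mxE ppS mulnC.
rewrite /pw /avg !size_map !big_map.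
by congr ((_ * _) ^+ 2 + (_ * _) ^+ 2); apply: eq_bigr => b _; rewrite /ecos /esin E.
Qed.

(** [Fn m B n] does not see the shift by [mulZ (pp m n) l], so the sum over l meets only the new
    factor and is 1 by [admissible_parseval]. The block of l = 0 is [L] itself, hence the prefix
    form. *)
Lemma tight_extend n L : tight n L -> exists rest, tight n.+1 (L ++ rest).
Proof.
move=> HL; have [L' HL'] := admissible_parseval _ _ (m0 n) (in_Dd_nil _ _ mB n) (admB n).
pose blk l := [seq x + mulZ (pp m n) l | x <- L].
exists (flatten [seq blk l | l <- L']) => xi.
have -> : L ++ flatten [seq blk l | l <- L'] = flatten [seq blk l | l <- 0 :: L'].
  rewrite /=; congr (_ ++ _); rewrite /blk -[LHS]map_id; apply: eq_map => x.
  by rewrite (_ : mulZ _ 0 = 0) ?addr0//; apply/rowP => i; rewrite !mxE mulr0.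
rewrite big_flatten big_map.
under eq_bigr => l _.
  rewrite big_map.
  under eq_bigr => x _.
    rewrite vecZD addrA FnS Fn_periodic// pw_factor sclD scl_mulZ; last first.
      by move=> i; exact: pp_gt0.
    over.
  over.
rewrite exchange_big /= -[RHS](HL xi); apply: eq_bigr => x _.
by rewrite -mulr_sumr HL' mulr1.
Qed.

Lemma tight_extendn n k L : tight n L -> exists rest, tight (n + k) (L ++ rest).
Proof.
move=> HL; elim: k => [|k [rest /tight_extend[rest' H]]].
  by exists [::]; rewrite addn0 cats0.
by exists (rest ++ rest'); rewrite addnS catA.
Qed.

Lemma tight_shift n L rest (z : 'rV[int]_d -> 'rV[int]_d) : tight n (L ++ rest) ->
  tight n (L ++ [seq l + mulZ (pp m n) (z l) | l <- rest]).
Proof.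
move=> HL xi; rewrite -[RHS](HL xi) !big_cat big_map /=; congr (_ + _).
by apply: eq_bigr => l _; rewrite vecZD addrA Fn_periodic.
Qed.

(** At xi = -l0 the term of l0 is already 1, so all other terms, being nonnegative, vanish; a
    repetition of l0 would contribute a second 1. *)
Lemma tight_orthogonal n L : tight n L -> uniq L /\
  {in L &, forall l l', l != l' -> Fn m B n (vecZ R l - vecZ R l') = 0}.
Proof.
move=> HL.
have H l0 l : l0 \in L -> l \in rem l0 L -> Fn m B n (vecZ R l - vecZ R l0) = 0.
  move=> l0L; have := HL (- vecZ R l0); rewrite (big_rem l0)//= addNr (Fn_at0 _ _ mB).
  move=> E; have /eqP : \sum_(l <- rem l0 L) Fn m B n (- vecZ R l0 + vecZ R l) = 0 by lra.
  rewrite psumr_eq0 => [|l' _]; last exact: Fn_ge0.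
  by move=> /allP S /S /eqP; rewrite addrC.
split; last by move=> l l' lL l'L ll'; apply: H => //; exact: rem_mem.
apply: count_mem_uniq => l0; case: (boolP (l0 \in L)) => [l0L|/count_memPn//].
rewrite (permP (perm_to_rem l0L)) /= eqxx; apply/eqP; rewrite eqSS.
apply/eqP/count_memPn; apply/negP => /(H _ _ l0L)/eqP.
by rewrite subrr (Fn_at0 _ _ mB) oner_eq0.
Qed.

Variable M : nat.
Hypothesis M0 : (0 < M)%N.
Hypothesis mM : forall n i, (m n i <= M)%N.

Lemma scl_small (x : 'rV[R]_d) (dl : R) : 0 < dl ->
  exists n0, forall n i, (n0 <= n)%N -> `|scl (pp m n) x 0 i| <= dl.
Proof.
move=> dl0; pose C := 1 + \sum_i `|x 0 i|.
have C0 : 0 < C by rewrite ltr_pwDl// sumr_ge0.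
have half : 0 <= (2^-1 : R) < 1 by apply/andP; split; lra.
have [n0 H] := expr_small _ _ half (divr_gt0 dl0 C0).
exists n0 => n i /H {}H; rewrite mxE normrM normfV (ger0_norm (ler0n R (pp m n i))).
have m2 k : (2 <= m k i)%N by exact: in_Dd_ge2 mB _ _.
have xC : `|x 0 i| <= C.
  by rewrite /C (bigD1 i)//= addrCA ler_wpDr// addr_ge0// sumr_ge0.
have := @mrad_ge R (m ^~ i) m2 n; rewrite -/(pp m n i) => H2.
rewrite (@le_trans _ _ (C * 2^-1 ^+ n))//.
  apply: ler_pM => //.
  by rewrite exprVn lef_pV2 ?posrE ?exprn_gt0// ltr0n pp_gt0.
by rewrite mulrC -ler_pdivlMr.
Qed.

(** Old frequencies, divided by a large enough scale, fall into the ball around 0; new ones are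
    translated to good positions. Half of the radius is spent on this, the other half absorbs the
    rescaled xi, and [FnD] turns the tail bound into the domination. *)
Lemma spectrum_tower : exists (e : R) (nn : nat -> nat) (LL : nat -> seq 'rV[int]_d),
  [/\ 0 < e, forall j, tight (nn j) (LL j), forall j, (j <= nn j)%N,
      forall j, exists rest, LL j.+1 = LL j ++ rest &
      forall xi, exists J, forall j, (J <= j)%N -> forall l, l \in LL j ->
        forall N, e * Fn m B (nn j) (xi + vecZ R l) <= Fn m B (nn j + N) (xi + vecZ R l)].
Proof.
have [e [dl [e0 dl0 EP]]] := @equipositive_ball R d _ M0.
have dl2 : 0 < dl / 2 by lra.
pose sh n : nat -> 'I_d -> nat := fun k => m (n + k)%N.
pose shB n : nat -> seq 'rV[int]_d := fun k => B (n + k)%N.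
pose good n L := forall l, l \in L -> forall N (y : 'rV[R]_d), (forall i, `|y 0 i| <= dl / 2) ->
   e <= Fn (sh n) (shB n) N (scl (pp m n) (vecZ R l) + y).
have step (p : nat * seq 'rV[int]_d) : exists q : nat * seq 'rV[int]_d, tight p.1 p.2 ->
    [/\ (p.1 < q.1)%N, tight q.1 q.2, exists rest, q.2 = p.2 ++ rest & good q.1 q.2].
  have [HL|?] := pselect (tight p.1 p.2); last by exists p.
  case: p HL => n L /= HL.
  have [n0 Hn0] : exists n0, forall l k i, l \in L -> (n0 <= k)%N ->
      `|scl (pp m k) (vecZ R l) 0 i| <= dl / 2.
    elim: L {HL} => [|l L [n0 IH]]; first by exists 0%N.
    have [n1 H1] := scl_small (vecZ R l) _ dl2.
    exists (maxn n0 n1) => l' k i; rewrite inE geq_max => /orP[/eqP -> /andP[_]|? /andP[? _]].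
      exact: H1.
    exact: IH.
  (* Level n0 makes every old frequency small; the extra 1 forces strict growth. *)
  pose n' := (n + (n0 + 1))%N.
  have [rest HL'] := tight_extendn n (n0 + 1) L HL.
  have [EP1 EP2] := EP (sh n') (shB n') (fun k => mB _) (fun k => mM _).
  have /choice[z Hz] := fun l => EP1 (scl (pp m n') (vecZ R l)).
  exists (n', L ++ [seq l + mulZ (pp m n') (z l) | l <- rest]); split=> /=.
  - by rewrite /n'; lia.
  - exact: tight_shift.
  - by eexists.
  - move=> l; rewrite mem_cat => /orP[lL|/mapP[l' _ ->]] N y Hy.
      apply: EP2 => i; rewrite mxE (le_trans (ler_normD _ _))//.
      have n0n' : (n0 <= n')%N by rewrite /n'; lia.
      by have := Hn0 l n' i lL n0n'; have := Hy i; lra.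
    rewrite vecZD sclD scl_mulZ; last by move=> i; exact: pp_gt0.
    by apply: Hz => i; rewrite (le_trans (Hy i))//; lra.
have [f Hf] := choice step.
(* At level 0 the convolution is the unit mass at 0, with spectrum {0}. *)
pose st j := iter j f (0%N, [:: 0]).
have st_tight j : tight (st j).1 (st j).2.
  elim: j => [|j /Hf[]//].
  by move=> xi /=; rewrite big_seq1 /Fn big_ord0.
exists e, (fun j => (st j).1), (fun j => (st j).2); split=> //.
- elim=> // j IH; have [H _ _ _] := Hf _ (st_tight j).
  exact: leq_ltn_trans H.
- by move=> j; have [] := Hf _ (st_tight j).
move=> xi; have [n0 Hn0] := scl_small xi _ dl2.
(* The successor excludes stage 0, which is not produced by [f] and carries no [good] property. *)
exists n0.+1 => -[//|j] jn l lL N; rewrite FnD// mulrC ler_wpM2l ?Fn_ge0//.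
have [H _ _ G] := Hf _ (st_tight j).
rewrite sclD addrC; apply: G => // i; apply: Hn0.
have : forall j, (j <= (st j).1)%N.
  elim=> // k IH; have [H' _ _ _] := Hf _ (st_tight k).
  exact: leq_ltn_trans H'.
by move=> /(_ j.+1); apply: leq_trans; exact: ltnW.
Qed.

Variable phi : 'rV[R]_d -> R.
Hypothesis Fn_cvg : forall xi, (fun n => Fn m B n xi) @ \oo --> phi xi.

Lemma phi_ge0 xi : 0 <= phi xi.
Proof.
rewrite -(cvg_lim _ (Fn_cvg xi))//; apply: limr_ge; first exact: cvgP (Fn_cvg xi).
by apply: nearW => n; exact: Fn_ge0.
Qed.

Lemma phi_le n xi : phi xi <= Fn m B n xi.
Proof.
rewrite -(cvg_lim _ (Fn_cvg xi))//; apply: limr_le; first exact: cvgP (Fn_cvg xi).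
by near=> k; apply: Fn_le; near: k; exists n.
Unshelve. all: by end_near. Qed.

Lemma phi_ge n c xi : (forall N, c <= Fn m B (n + N) xi) -> c <= phi xi.
Proof.
move=> H; rewrite -(cvg_lim _ (Fn_cvg xi))//; apply: limr_ge; first exact: cvgP (Fn_cvg xi).
near=> k; have kn : (n <= k)%N by near: k; exists n.
by rewrite -(subnKC kn).
Unshelve. all: by end_near. Qed.

Lemma sum_phi_cvg L xi : (fun n => \sum_(l <- L) Fn m B n (xi + vecZ R l)) @ \oo -->
  \sum_(l <- L) phi (xi + vecZ R l).
Proof.
elim: L => [|l L IH].
  by under eq_fun do rewrite big_nil; rewrite big_nil; exact: cvg_cst.
under eq_fun do rewrite big_cons; rewrite big_cons.
by apply: cvgD => //; exact: Fn_cvg.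
Qed.

(** The partial sums [T] of [phi] increase and stay below 1, so beyond some stage they gain at most
    e c. By domination the frequencies added later then carry at most c of the total 1 of [Fn], and
    the earlier ones at least 1 - c. *)
Lemma spectrum_exists : exists LL : nat -> seq 'rV[int]_d,
  [/\ forall j, uniq (LL j),
      forall j j', (j <= j')%N -> {subset LL j <= LL j'},
      forall j, {in LL j &, forall l l', l != l' -> phi (vecZ R l - vecZ R l') = 0} &
      forall xi c, 0 < c -> exists j, 1 - c <= \sum_(l <- LL j) phi (xi + vecZ R l)].
Proof.
have [e [nn [LL [e0 tLL nnj LLS HJ]]]] := spectrum_tower.
have LLle j j' : (j <= j')%N -> exists rest, LL j' = LL j ++ rest.
  move=> /subnK <-; elim: (j' - j)%N => [|k [rest E]]; first by exists [::]; rewrite cats0.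
  by have [rest' E'] := LLS (k + j)%N; exists (rest ++ rest'); rewrite addSn E' E catA.
exists LL; split.
- by move=> j; have [] := tight_orthogonal _ _ (tLL j).
- by move=> j j' /LLle[rest ->] l lL; rewrite mem_cat lL.
- move=> j l l' lL l'L ll'; apply/eqP; rewrite eq_le phi_ge0 andbT.
  have [_ /(_ l l' lL l'L ll') <-] := tight_orthogonal _ _ (tLL j).
  exact: phi_le.
move=> xi c c0.
pose T j := \sum_(l <- LL j) phi (xi + vecZ R l).
have T1 j : T j <= 1.
  by rewrite -(tLL j xi); apply: ler_sum => l _; exact: phi_le.
have Tle j j' : (j <= j')%N -> T j <= T j'.
  by move=> /LLle[rest E]; rewrite /T E big_cat /= lerDl sumr_ge0// => l _; exact: phi_ge0.
have [J {}HJ] := HJ xi.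
have supT : has_sup (range T).
  by split; [exists (T 0%N), 0%N|exists 1 => _ [j _ <-]].
have ec0 : 0 < e * c by rewrite mulr_gt0.
have [_ [j0 _ <-] Hj0] := sup_adherent ec0 supT.
pose j1 := maxn j0 J; exists j1.
have Hj1 j : T j - T j1 <= e * c.
  have : T j <= sup (range T) by apply: ub_le_sup; [case: supT|exists j].
  have := Tle _ _ (leq_maxl j0 J); rewrite -/j1; lra.
have key j : (j1 <= j)%N -> 1 - c <= \sum_(l <- LL j1) Fn m B (nn j) (xi + vecZ R l).
  move=> j1j; have [rest E] := LLle _ _ j1j.
  have := tLL j xi; rewrite E big_cat /= => H.
  have : e * \sum_(l <- rest) Fn m B (nn j) (xi + vecZ R l) <= \sum_(l <- rest) phi (xi + vecZ R l).
    rewrite mulr_sumr big_seq [leRHS]big_seq; apply: ler_sum => l lr.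
    apply: (phi_ge (nn j)); apply: HJ; last by rewrite E mem_cat lr orbT.
    exact: leq_trans (leq_maxr _ _) j1j.
  have := Hj1 j; rewrite /T E big_cat /= addrAC subrr add0r => H1 /le_trans/(_ H1).
  rewrite ler_pM2l//; lra.
(* Over the fixed list [LL j1] the sum passes to the limit; monotonicity compares level n with the
   later level [nn (maxn j1 n)]. *)
have := sum_phi_cvg (LL j1) xi => /[dup] /cvgP Cv /(cvg_lim _) <-//.
apply: limr_ge => //; near=> n.
have /key/le_trans : (j1 <= maxn j1 n)%N by rewrite leq_maxl.
apply; apply: ler_sum => l _; apply: Fn_le.
exact: leq_trans (leq_maxr _ _) (nnj _).
Unshelve. all: by end_near. Qed.

End Tight.

(** * Polynomials approximating a threshold *)

Section Threshold.
Context {R : realType}.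

Lemma cvg_natM_expr (q : R) : 0 <= q < 1 -> (fun n => n%:R * q ^+ n) @ \oo --> 0.
Proof.
move=> /andP[q0 q1]; pose s := (1 - q) / 2; have s0 : 0 < s by rewrite /s; lra.
have q'1 : `|q * (1 + s)| < 1 by rewrite ger0_norm /s; nra.
have H n : 1 + n%:R * s <= (1 + s) ^+ n.
  elim: n => [|n IH]; first by rewrite mul0r addr0 expr0.
  rewrite exprS -natr1.
  have : (1 + s) * (1 + n%:R * s) <= (1 + s) * (1 + s) ^+ n by rewrite ler_pM2l//; lra.
  have : 0 <= n%:R * s ^+ 2 by rewrite mulr_ge0 ?sqr_ge0.
  nra.
apply: (@squeeze_cvgr _ _ _ _ (fun=> 0) (fun n => s^-1 * (q * (1 + s)) ^+ n)).
- near=> n; rewrite mulr_ge0 ?exprn_ge0//= exprMn mulrCA [leRHS]mulrA.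
  rewrite mulrC -mulrA ler_wpM2l ?exprn_ge0//.
  rewrite ler_pdivlMl// mulrC.
  by rewrite (le_trans _ (H n))// lerDr.
- exact: cvg_cst.
- rewrite -[X in _ --> X](mulr0 s^-1); apply: cvgM; first exact: cvg_cst.
  exact: cvg_expr.
Unshelve. all: by end_near. Qed.

(* The exponents of Brosowski and Deutsch's proof of the Stone-Weierstrass theorem;
   the factor [n] settles the case [t = 1/2]. *)
Definition step_poly n (t : R) : R := 1 - (1 - t ^+ n) ^+ (n * 2 ^ n).

Lemma step_poly_bounds n (t : R) : 0 <= t <= 1 -> 0 <= step_poly n t <= 1.
Proof.
move=> /andP[t0 t1]; have := exprn_ge0 n t0; have : t ^+ n <= 1 by rewrite exprn_ile1.
move=> y1 y0; have z0 : 0 <= 1 - t ^+ n by lra.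
rewrite /step_poly subr_ge0 exprn_ile1//; last lra.
by rewrite lerBlDr lerDl exprn_ge0.
Qed.

Lemma step_poly_cvg (t : R) : 0 <= t <= 1 ->
  step_poly n t @[n --> \oo] --> ((2^-1 <= t)%R%:R : R).
Proof.
move=> /[dup] t01 /andP[t0 t1].
have y01 n : 0 <= t ^+ n <= 1 by rewrite exprn_ge0// exprn_ile1.
have [th|th] := leP 2^-1 t; last first.
  (* Bernoulli's inequality bounds the polynomial by n (2t)^n, and 2t < 1. *)
  apply: (@squeeze_cvgr _ _ _ _ (fun=> 0) (fun n => n%:R * (2 * t) ^+ n)).
  - near=> n; have /andP[-> _] /= := step_poly_bounds n t t01.
    have := bernoulli_ineq _ (n * 2 ^ n) (y01 n).
    by rewrite /step_poly natrM natrX exprMn mulrA; lra.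
  - exact: cvg_cst.
  - by apply: cvg_natM_expr; apply/andP; split; lra.
(* Here (1 - y)^N <= 1 / (1 + N y), with N y = n (2t)^n >= n. *)
apply: (@squeeze_cvgr _ _ _ _ (fun n => 1 - n.+1%:R^-1) (fun=> 1)).
- near=> n; have /andP[_ ->] := step_poly_bounds n t t01; rewrite andbT.
  rewrite /step_poly lerB//; set y := t ^+ n; set N := (n * 2 ^ n)%N.
  have /andP[y0 y1] : 0 <= y <= 1 := y01 n.
  have Ny : n%:R <= N%:R * y.
    rewrite /N natrM natrX -mulrA ler_peMr// /y -exprMn exprn_ege1//; lra.
  have H k : (1 - y) ^+ k * (1 + k%:R * y) <= 1.
    elim: k => [|k IH]; first by rewrite expr0 mul0r addr0 mul1r.
    apply: le_trans IH; rewrite exprSr -mulrA ler_wpM2l ?exprn_ge0//; first lra.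
    rewrite -natr1; have : 0 <= k%:R * y ^+ 2 by rewrite mulr_ge0 ?sqr_ge0.
    nra.
  rewrite -[leRHS]mul1r ler_pdivlMr ?ltr0n// (le_trans _ (H N))//.
  rewrite ler_wpM2l ?exprn_ge0//; first lra.
  by rewrite -natr1; lra.
- rewrite -[X in _ --> X]subr0; apply: cvgB; first exact: cvg_cst.
  exact: cvg_harmonic.
- exact: cvg_cst.
Unshelve. all: by end_near. Qed.

End Threshold.

(** * Integration against a signed density *)

Section FourierUniqueness.
Context {R : realType} {d : nat}.
Notation T := (BorelRd R d).
Implicit Types (h w : T -> R) (xi : 'rV[R]_d).

Lemma continuous_measurable_rV (f : 'rV[R]_d -> R) :
  continuous f -> measurable_fun setT (f : T -> R).
Proof.
move=> cf; apply: (measurability _ (RGenOInfty.measurableE R)).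
move=> /= _ [_ [a ->]] <-; rewrite setTI; apply: sub_sigma_algebra.
by apply: (open_comp (fun x _ => cf x)); exact: interval_open.
Qed.

Lemma continuous_dotp xi : continuous (dotp xi).
Proof.
have C i : xpredT i -> continuous (fun x : 'rV[R]_d => xi 0 i * x 0 i).
  by move=> _ x; apply: continuousM; [exact: cst_continuous|exact: coord_continuous].
exact: (continuous_big (x0 := 0) add_continuous (r := index_enum 'I_d) C).
Qed.

Lemma continuous_ecos xi : continuous (ecos xi).
Proof.
move=> x; apply: (@continuous_comp _ _ _ (fun x => 2 * pi * dotp xi x) cos).
  by apply: continuousM; [exact: cst_continuous|exact: continuous_dotp].
exact: continuous_cos.
Qed.

Lemma continuous_esin xi : continuous (esin xi).
Proof.
move=> x; apply: (@continuous_comp _ _ _ (fun x => 2 * pi * dotp xi x) sin).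
  by apply: continuousM; [exact: cst_continuous|exact: continuous_dotp].
exact: continuous_sin.
Qed.

Definition bmeas h := measurable_fun setT h /\ exists C, forall x, `|h x| <= C.

Lemma bmeas_ecos xi : bmeas (ecos xi).
Proof.
split; first exact: continuous_measurable_rV (continuous_ecos xi).
by exists 1 => x; exact: cos_max.
Qed.

Lemma bmeas_esin xi : bmeas (esin xi).
Proof.
split; first exact: continuous_measurable_rV (continuous_esin xi).
by exists 1 => x; exact: sin_max.
Qed.

Lemma bmeasD h w : bmeas h -> bmeas w -> bmeas (fun x => h x + w x).
Proof.
move=> [mh [C hC]] [mw [D wD]]; split; first exact: measurable_funD.
by exists (C + D) => x; rewrite (le_trans (ler_normD _ _))// lerD.
Qed.

Lemma bmeasM h w : bmeas h -> bmeas w -> bmeas (fun x => h x * w x).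
Proof.
move=> [mh [C hC]] [mw [D wD]]; split; first exact: measurable_funM.
by exists (C * D) => x; rewrite normrM ler_pM.
Qed.

Lemma bmeas_cst (c : R) : bmeas (fun=> c).
Proof. by split; [exact: measurable_cst|exists `|c|]. Qed.

Lemma bmeas_lim (h : nat -> T -> R) w (C : R) :
  (forall n, bmeas (h n)) -> (forall n x, `|h n x| <= C) ->
  (forall x, h n x @[n --> \oo] --> w x) -> bmeas w.
Proof.
move=> bh hC hw; split.
  by apply: (@measurable_fun_cvg _ _ _ setT h) => // n; case: (bh n).
exists C => x; have N : `|h n x| @[n --> \oo] --> `|w x| by apply: cvg_norm; exact: hw.
rewrite -(cvg_lim _ N)//.
by apply: limr_le; [exact: cvgP N|apply: nearW => n; exact: hC].
Qed.

Variable mu : probability (BorelRd R d) R.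
Variable u : T -> R.
Hypothesis iu : mu.-integrable setT (EFin \o u).

(** Integration against the signed measure u mu, for bounded Borel h. *)
Definition wint h : R := \int[mu]_x (u x * h x).

Lemma bmeas_bounded h : bmeas h -> [bounded h x | x in [set: T]].
Proof.
move=> [_ [C hC]]; exists C; split; first exact: num_real.
by move=> M CM x _; exact: le_trans (hC x) (ltW CM).
Qed.

Lemma integrable_wint h : bmeas h -> mu.-integrable setT (EFin \o (fun x => u x * h x)).
Proof.
move=> bh; have := integrableMl measurableT iu bh.1 (bmeas_bounded h bh).
by apply: eq_integrable => //.
Qed.

Lemma wintD h w : bmeas h -> bmeas w -> wint (fun x => h x + w x) = wint h + wint w.
Proof.
move=> bh bw; rewrite /wint -RintegralD//; try exact: integrable_wint.
by apply: eq_Rintegral => x _; rewrite mulrDr.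
Qed.

Lemma wintZ (c : R) h : bmeas h -> wint (fun x => c * h x) = c * wint h.
Proof.
move=> bh; rewrite /wint -RintegralZl//; try exact: integrable_wint.
by apply: eq_Rintegral => x _; rewrite mulrCA.
Qed.

Lemma eq_wint h w : h =1 w -> wint h = wint w.
Proof. by move=> /funext ->. Qed.

Lemma wint_lim0 (h : nat -> T -> R) w (C : R) :
  (forall n, bmeas (h n)) -> (forall n x, `|h n x| <= C) ->
  (forall x, h n x @[n --> \oo] --> w x) ->
  (forall n, wint (h n) = 0) -> wint w = 0.
Proof.
move=> bh hC hw h0; have bw := bmeas_lim h w C bh hC hw.
have mi v : bmeas v -> measurable_fun setT (EFin \o (fun x => u x * v x)).
  by move=> bv; exact: measurable_int (integrable_wint v bv).
have [|||||_ _] := @dominated_convergence _ T R mu setT measurableT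
   (fun n => EFin \o (fun x => u x * h n x)) (EFin \o (fun x => u x * w x))
   (fun x => (C%:E * `|(u x)%:E|)%E).
- by move=> n; exact: mi.
- exact: mi.
- apply: aeW => x _; apply: cvg_EFin; first exact: nearW.
  by apply: cvgM; [exact: cvg_cst|exact: hw].
- by apply: integrableZl => //; exact: integrable_abse iu.
- by apply: aeW => x n _ /=; rewrite lee_fin normrM mulrC ler_wpM2r.
have -> : [sequence (\int[mu]_x (EFin \o (fun x => (u x * h n x)%R)) x)%E]_n = (fun=> 0%E).
  apply/funext => n /=; rewrite -[LHS]fineK; first by congr EFin; exact: h0.
  exact: (integrable_fin_num measurableT (integrable_wint _ (bh n))).
move=> /(cvg_lim _); rewrite lim_cst// => /(_ (@ereal_hausdorff R)) E.
exact: (congr1 fine (esym E)).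
Qed.

End FourierUniqueness.

(** * Multipliers preserving a vanishing Fourier transform *)

Section Multipliers.
Context {R : realType} {d : nat}.
Notation T := (BorelRd R d).
Implicit Types (h w : T -> R) (xi : 'rV[R]_d).
Variable mu : probability (BorelRd R d) R.
Variable u : T -> R.
Hypothesis iu : mu.-integrable setT (EFin \o u).

Let J := wint mu u.

(** The signed measure h u mu has zero Fourier transform; asking this at all frequencies makes it
    stable under multiplication by exponentials. *)
Definition annih h := bmeas h /\
  forall xi, J (fun x => h x * ecos xi x) = 0 /\ J (fun x => h x * esin xi x) = 0.

(** Unlike [annih], this class is closed under products by construction, and it inherits linearity
    and bounded limits. *)
Definition multiplier w := bmeas w /\ forall h, annih h -> annih (fun x => h x * w x).

Lemma annih_lin (a b : R) h w : annih h -> annih w -> annih (fun x => a * h x + b * w x).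
Proof.
move=> [bh Ah] [bw Aw].
have L v : bmeas v -> J (fun x => h x * v x) = 0 -> J (fun x => w x * v x) = 0 ->
    J (fun x => (a * h x + b * w x) * v x) = 0.
  move=> bv hv wv.
  rewrite /J (eq_wint _ _ _ (fun x => a * (h x * v x) + b * (w x * v x))); last first.
    by move=> x; ring.
  have bhv := bmeasM h v bh bv; have bwv := bmeasM w v bw bv.
  rewrite wintD//; try by apply: bmeasM => //; exact: bmeas_cst.
  by rewrite !wintZ// -!/(J _) hv wv !mulr0 addr0.
split; first by apply: bmeasD; apply: bmeasM => //; exact: bmeas_cst.
by move=> xi; have [? ?] := Ah xi; have [? ?] := Aw xi; split; apply: L => //;
  [exact: bmeas_ecos|exact: bmeas_esin].
Qed.

Lemma eq_annih h w : h =1 w -> annih h -> annih w.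
Proof. by move=> /funext ->. Qed.

Lemma annih_lim (h : nat -> T -> R) w (C : R) :
  (forall n, annih (h n)) -> (forall n x, `|h n x| <= C) ->
  (forall x, h n x @[n --> \oo] --> w x) -> annih w.
Proof.
move=> Ah hC hw.
have L v : bmeas v -> (forall x, `|v x| <= 1) -> (forall n, J (fun x => h n x * v x) = 0) ->
    J (fun x => w x * v x) = 0.
  move=> bv v1 H; apply: (wint_lim0 _ _ iu (fun n x => h n x * v x) _ C) => //.
  - by move=> n; apply: bmeasM => //; case: (Ah n).
  - by move=> n x; rewrite normrM -[leRHS]mulr1 ler_pM.
  - by move=> x; apply: cvgM => //; exact: cvg_cst.
split; first by apply: bmeas_lim hC hw => n; case: (Ah n).
move=> xi; split; apply: L; first exact: bmeas_ecos.
- by move=> x; exact: cos_max.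
- by move=> n; have [_ /(_ xi)[]] := Ah n.
- exact: bmeas_esin.
- by move=> x; exact: sin_max.
- by move=> n; have [_ /(_ xi)[]] := Ah n.
Qed.

Lemma eq_mult h w : h =1 w -> multiplier h -> multiplier w.
Proof. by move=> /funext ->. Qed.

Lemma mult_cst (c : R) : multiplier (fun=> c).
Proof.
split; first exact: bmeas_cst.
move=> h Ah; apply: eq_annih (annih_lin c 0 h h Ah Ah) => x; ring.
Qed.

Lemma mult_lin (a b : R) h w : multiplier h -> multiplier w -> multiplier (fun x => a * h x + b * w x).
Proof.
move=> [bh Mh] [bw Mw]; split.
  by apply: bmeasD; apply: bmeasM => //; exact: bmeas_cst.
move=> k Ak; apply: eq_annih (annih_lin a b _ _ (Mh _ Ak) (Mw _ Ak)) => x; ring.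
Qed.

Lemma multM h w : multiplier h -> multiplier w -> multiplier (fun x => h x * w x).
Proof.
move=> [bh Mh] [bw Mw]; split; first exact: bmeasM.
by move=> k Ak; apply: eq_annih (Mw _ (Mh _ Ak)) => x; rewrite mulrA.
Qed.

Lemma multX h n : multiplier h -> multiplier (fun x => h x ^+ n).
Proof.
move=> Mh; elim: n => [|n IH].
  by apply: eq_mult (mult_cst 1) => x; rewrite expr0.
by apply: eq_mult (multM _ _ Mh IH) => x; rewrite exprS.
Qed.

Lemma mult_onem h : multiplier h -> multiplier (fun x => 1 - h x).
Proof.
move=> Mh; apply: eq_mult (mult_lin 1 (-1) _ _ (mult_cst 1) Mh) => x; ring.
Qed.

Lemma mult_prod I (s : seq I) (h : I -> T -> R) :
  (forall i, multiplier (h i)) -> multiplier (fun x => \prod_(i <- s) h i x).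
Proof.
move=> Mh; elim: s => [|i s IH].
  by apply: eq_mult (mult_cst 1) => x; rewrite big_nil.
by apply: eq_mult (multM _ _ (Mh i) IH) => x; rewrite big_cons.
Qed.

Lemma mult_lim (h : nat -> T -> R) w (C : R) :
  (forall n, multiplier (h n)) -> (forall n x, `|h n x| <= C) ->
  (forall x, h n x @[n --> \oo] --> w x) -> multiplier w.
Proof.
move=> Mh hC hw; split; first by apply: bmeas_lim hC hw => n; case: (Mh n).
move=> k Ak; have [_ [D kD]] := Ak.1.
apply: (annih_lim (fun n x => k x * h n x) _ (D * C)).
- by move=> n; have [_] := Mh n; apply.
- by move=> n x; rewrite normrM ler_pM.
- by move=> x; apply: cvgM => //; exact: cvg_cst.
Qed.

Lemma wint_comb0 (v1 v2 : T -> R) (a b : R) h w : bmeas h -> bmeas v1 -> bmeas v2 ->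
  (forall x, w x = a * (h x * v1 x) + b * (h x * v2 x)) ->
  J (fun x => h x * v1 x) = 0 -> J (fun x => h x * v2 x) = 0 -> J w = 0.
Proof.
move=> bh b1 b2 wE J1 J2; rewrite /J (eq_wint _ _ _ _ wE).
rewrite wintD//; try by apply: bmeasM; [exact: bmeas_cst|exact: bmeasM].
by rewrite !wintZ//; try exact: bmeasM; rewrite -!/(J _) J1 J2 !mulr0 addr0.
Qed.

Lemma mult_ecos eta : multiplier (ecos eta).
Proof.
split=> [|h [bh Ah]]; first exact: bmeas_ecos.
split; first by apply: bmeasM => //; exact: bmeas_ecos.
move=> xi.
have [C1 S1] := Ah (xi + eta); have [C2 S2] := Ah (xi - eta).
split.
  apply: (wint_comb0 (ecos (xi + eta)) (ecos (xi - eta)) 2^-1 2^-1 h) => //; try exact: bmeas_ecos.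
  by move=> x; rewrite ecosDl ecosBl; field.
apply: (wint_comb0 (esin (xi + eta)) (esin (xi - eta)) 2^-1 2^-1 h) => //; try exact: bmeas_esin.
by move=> x; rewrite esinDl esinBl; field.
Qed.

Lemma mult_esin eta : multiplier (esin eta).
Proof.
split=> [|h [bh Ah]]; first exact: bmeas_esin.
split; first by apply: bmeasM => //; exact: bmeas_esin.
move=> xi.
have [C1 S1] := Ah (xi + eta); have [C2 S2] := Ah (xi - eta).
split.
  apply: (wint_comb0 (esin (xi + eta)) (esin (xi - eta)) 2^-1 (- 2^-1) h) => //; try exact: bmeas_esin.
  by move=> x; rewrite esinDl esinBl; field.
apply: (wint_comb0 (ecos (xi - eta)) (ecos (xi + eta)) 2^-1 (- 2^-1) h) => //; try exact: bmeas_ecos.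
by move=> x; rewrite ecosBl ecosDl; field.
Qed.

Lemma mult_step w : multiplier w -> (forall x, 0 <= w x <= 1) ->
  multiplier (fun x => (2^-1 <= w x)%R%:R).
Proof.
move=> Mw w01; apply: (mult_lim (fun n x => step_poly n (w x)) _ 1).
- by move=> n; apply: mult_onem; apply: multX; apply: mult_onem; exact: multX.
- by move=> n x; have /andP[? ?] := step_poly_bounds n _ (w01 x); rewrite ger0_norm.
- by move=> x; exact: step_poly_cvg.
Qed.

(** The slow sine of pi (x_i - a) / (j + 1) has the sign of x_i - a once |x_i - a| < j + 1.
    Thresholding (1 + s) / 2 at 1/2 reads off this sign, correctly at each point for large j. *)
Lemma mult_halfspace i (a : R) : multiplier (fun x => (a <= (x : 'rV[R]_d) 0 i)%R%:R).
Proof.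
pose c (j : nat) : R := (2 * j.+1%:R)^-1.
pose s j (x : 'rV[R]_d) := sin (2 * pi * (c j * (x 0 i - a))).
have Ms j : multiplier (fun x => (1 + s j x) / 2).
  pose eta : 'rV[R]_d := c j *: delta_mx 0 i.
  have E x : dotp eta x = c j * x 0 i.
    rewrite /dotp (bigD1 i)//= !mxE !eqxx mulr1 big1 ?addr0// => k ki.
    by rewrite !mxE (negPf ki) andbF mulr0 mul0r.
  pose th := 2 * pi * (c j * a).
  have := mult_lin (cos th) (- sin th) _ _ (mult_esin eta) (mult_ecos eta).
  move=> /(mult_lin 2^-1 2^-1 _ _ (mult_cst 1)); apply: eq_mult => x.
  by rewrite /s /esin /ecos E !mulrBr sinB -/th; field.
apply: (mult_lim (fun (j : nat) (x : T) => (2^-1 <= (1 + s j x) / 2)%R%:R : R) _ 1).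
- move=> j; apply: mult_step => // x.
  have := sin_geN1 (2 * pi * (c j * ((x : 'rV[R]_d) 0 i - a))).
  by have := sin_le1 (2 * pi * (c j * ((x : 'rV[R]_d) 0 i - a))); rewrite -/(s j x); lra.
- by move=> j x; case: (2^-1 <= _)%R; rewrite ?normr1 ?normr0.
move=> x; apply: cvg_near_cst.
have [n0 _ Hn0] : \forall j \near \oo, `|(x : 'rV[R]_d) 0 i - a| < j.+1%:R.
  have := nbhs_infty_gtr `|(x : 'rV[R]_d) 0 i - a| => [[n0 _ H]]; exists n0 => // n /H /= H'.
  by rewrite (lt_trans H')// ltr_nat.
exists n0 => // j /Hn0 /= Hj; congr ((nat_of_bool _)%:R).
set y := _ - a in Hj *.
have -> : (2^-1 <= (1 + s j x) / 2) = (0 <= s j x) by apply/idP/idP; lra.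
rewrite -(subr_ge0 a) -/y /s -/y.
have -> : 2 * pi * (c j * y) = pi * (y / j.+1%:R) by rewrite /c invfM; move: (j.+1%:R^-1) => q; lra.
have pi0 := @pi_gt0 R.
have j0 : 0 < j.+1%:R :> R by [].
have [y0|y0] := leP 0 y.
  apply: sin_ge0_pi; rewrite mulr_ge0 ?divr_ge0 ?(ltW pi0)//= ler_piMr ?(ltW pi0)//.
  by rewrite ler_pdivrMr// mul1r (le_trans (ler_norm y))// ltW.
apply/negbTE; rewrite -ltNge -oppr_gt0 -sinN; apply: sin_gt0_pi.
rewrite -mulrN -mulNr mulr_gt0 ?divr_gt0 ?oppr_gt0//= -[ltRHS]mulr1 ltr_pM2l//.
by rewrite ltr_pdivrMr// mul1r (le_lt_trans _ Hj)// -normrN ler_norm.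
Qed.

Definition msets : set (set T) := [set A | multiplier (\1_A)].

Lemma sigma_algebra_msets : sigma_algebra setT msets.
Proof.
split.
- by apply: eq_mult (mult_cst 0) => x; rewrite indicE memNset.
- move=> A MA; apply: eq_mult (mult_onem _ MA) => x.
  by rewrite setTD !indicE in_setC; case: (x \in A); rewrite ?subrr ?subr0.
(* One minus a product is the indicator of a finite union; at each point the sequence is eventually
   constant. *)
move=> A MA; apply: (mult_lim (fun n x => 1 - \prod_(k <- iota 0 n) (1 - \1_(A k) x)) _ 1).
- by move=> n; apply: mult_onem; apply: mult_prod => k; exact: (mult_onem (\1_(A k)) (MA k)).
- move=> n x; have : 0 <= \prod_(k <- iota 0 n) (1 - \1_(A k) x : R) <= 1.
    have b01 k : 0 <= (1 - \1_(A k) x : R) <= 1.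
      by rewrite indicE; case: (x \in A k); rewrite ?subrr ?subr0 ?lexx ?ler01.
    rewrite prodr_ge0 => [|k _]; last by have /andP[] := b01 k.
    by rewrite prodr_ile1.
  move=> /andP[p0 p1]; rewrite ger0_norm; lra.
move=> x; apply: cvg_near_cst; rewrite !indicE.
have [[k _ Akx]|nA] := pselect ((\bigcup_k A k) x).
  rewrite mem_set; last by exists k.
  exists k.+1 => // n /= kn.
  have kin : k \in iota 0 n by rewrite mem_iota.
  by rewrite (big_rem k)//= indicE mem_set// subrr mul0r subr0.
rewrite memNset//; exists 0%N => // n _.
rewrite big1 ?subrr// => k _; rewrite indicE memNset ?subr0// => Akx.
by apply: nA; exists k.
Qed.

(** Half-open grid boxes are intersections of half-spaces and their complements, and an open set is
    the union of the countably many boxes it contains. *)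
Lemma open_msets : (@open 'rV[R]_d) `<=` msets.
Proof.
move=> U oU; have [_ _ MU] := sigma_algebra_msets.
pose box (p : nat * 'rV[int]_d) : set T := [set x | forall i,
  (p.2 0 i)%:~R / p.1.+1%:R <= (x : 'rV[R]_d) 0 i < (p.2 0 i + 1)%:~R / p.1.+1%:R].
have Mbox p : multiplier (\1_(box p)).
  pose f i (x : T) : R := ((p.2 0 i)%:~R / p.1.+1%:R <= (x : 'rV[R]_d) 0 i)%R%:R
    * (1 - ((p.2 0 i + 1)%:~R / p.1.+1%:R <= (x : 'rV[R]_d) 0 i)%R%:R).
  have Mf i : multiplier (f i).
    by apply: multM; [exact: mult_halfspace|apply: mult_onem; exact: mult_halfspace].
  apply: eq_mult (mult_prod _ (index_enum 'I_d) f Mf) => x.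
  have fE i : f i x = ((p.2 0 i)%:~R / p.1.+1%:R <= (x : 'rV[R]_d) 0 i
     < (p.2 0 i + 1)%:~R / p.1.+1%:R)%R%:R.
    by rewrite /f ltNge; case: (_ <= _); case: (_ <= _); rewrite ?subrr ?subr0 ?mulr1 ?mulr0 ?mul0r.
  rewrite indicE; have [xb|xb] := pselect (box p x).
    by rewrite mem_set// big1// => i _; rewrite fE (xb i).
  rewrite memNset//; move: xb => /existsNP[i /negP/negPf xb].
  by rewrite (bigD1 i)//= fE xb mul0r.
(* Boxes are enumerated by their codes; a number without a box, or whose box is not inside U, gives
   the empty set. *)
pose A n := if unpickle n is Some p then (if `[< box p `<=` U >] then box p else set0) else set0.
have MA n : msets (A n).
  have M0 : msets set0 by case: sigma_algebra_msets.
  by rewrite /A; case: (unpickle n) => // p; case: ifP => // _; exact: Mbox.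
suff -> : U = \bigcup_n A n by exact: MU.
apply/seteqP; split=> x; last first.
  by move=> [n _]; rewrite /A; case: (unpickle n) => // p; case: ifPn => // /asboolP; apply.
move=> Ux; have /nbhs_ballP[e /= e0 He] := open_nbhs_nbhs (conj oU Ux).
have [n _ /(_ n (leqnn n)) /= Hn] : \forall n \near \oo, n.+1%:R^-1 < e.
  exact: (near_infty_natSinv_lt (PosNum e0)).
pose z : 'rV[int]_d := \row_i Num.floor (n.+1%:R * x 0 i).
have n0 : 0 < n.+1%:R :> R by [].
have zE (y : R) i : ((z 0 i)%:~R / n.+1%:R <= y < (z 0 i + 1)%:~R / n.+1%:R)%R =
    ((Num.floor (n.+1%:R * x 0 i))%:~R <= n.+1%:R * y < (Num.floor (n.+1%:R * x 0 i) + 1)%:~R).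
  by rewrite /z mxE ler_pdivrMr// ltr_pdivlMr// [y * _]mulrC.
exists (pickle (n, z)) => //; rewrite /A pickleK ifT.
  by move=> i; rewrite /= zE floor_itv.
apply/asboolP => y yb; apply: He; split=> // j i; rewrite (ord1 j) /ball /=.
have := yb i; rewrite /= zE intrD => /andP[y1 y2].
have /andP[] := floor_itv (n.+1%:R * x 0 i); rewrite intrD => x1 x2.
have H : `|n.+1%:R * (x 0 i - y 0 i)| < 1 by rewrite ltr_norml; lra.
rewrite (lt_trans _ Hn)// -[ltRHS]mul1r ltr_pdivlMr// mulrC.
by rewrite normrM ger0_norm in H.
Qed.

(** Every Borel indicator is a multiplier; applied to the constant 1, at frequency 0, this is the
    integral itself. *)
Lemma wint_indic (A : set T) : measurable A -> annih (fun=> 1) -> J (\1_A) = 0.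
Proof.
move=> mA A1.
have [_ /(_ _ A1)[_ /(_ 0)[H _]]] : msets A.
  exact: (smallest_sub sigma_algebra_msets open_msets).
rewrite -[RHS]H; apply: eq_wint => x.
by rewrite /ecos dotp0l mulr0 cos0 mul1r mulr1.
Qed.

End Multipliers.

(** * Uniqueness for the Fourier transform *)

Section UniquenessTheorem.
Context {R : realType} {d : nat}.
Variable mu : probability (BorelRd R d) R.

(** The measure u mu vanishes on Borel sets; with P = {u >= 0}, the integral of |u| is twice that of
    u over P minus that of u, hence 0. *)
Lemma fourier_uniqueness (u : BorelRd R d -> R) : mu.-integrable setT (EFin \o u) ->
  (forall xi, \int[mu]_x (u x * ecos xi x) = 0 /\ \int[mu]_x (u x * esin xi x) = 0) ->
  {ae mu, forall x, u x = 0}.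
Proof.
move=> iu H.
have A1 : annih mu u (fun=> 1).
  split=> [|xi]; first exact: bmeas_cst.
  have [C S] := H xi; split; [rewrite -[RHS]C|rewrite -[RHS]S];
    by apply: eq_Rintegral => x _; rewrite mul1r.
have mu' : measurable_fun setT u by apply/measurable_EFinP; exact: measurable_int iu.
pose P : set (BorelRd R d) := [set x | 0 <= u x].
have mP : measurable P by rewrite -[P]setTI; exact: measurable_fun_le.
have J1 := wint_indic mu u iu P mP A1.
have J0 := wint_indic mu u iu setT measurableT A1.
have iP : mu.-integrable setT (EFin \o (fun x => u x * \1_P x)).
  apply: integrable_wint => //; split; first exact: measurable_indic.
  by exists 1 => x; rewrite indicE; case: (_ \in _); rewrite ?normr1 ?normr0.
have iT : mu.-integrable setT (EFin \o (fun x => u x * \1_setT x)).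
  apply: integrable_wint => //; split; first exact: measurable_indic.
  by exists 1 => x; rewrite indicE; case: (_ \in _); rewrite ?normr1 ?normr0.
have : \int[mu]_x `|u x| = 0.
  transitivity (\int[mu]_x (2 * (u x * \1_P x) - u x * \1_setT x)).
    apply: eq_Rintegral => x _; rewrite !indicE in_setT mulr1.
    have [u0|u0] := leP 0 (u x).
      by rewrite mem_set// mulr1 ger0_norm//; ring.
    by rewrite memNset ?ltr0_norm// ?mulr0 ?sub0r//= => /le_lt_trans/(_ u0); rewrite ltxx.
  rewrite RintegralB//; last first.
    by have := integrableZl measurableT 2 iP; apply: eq_integrable => //.
  by rewrite RintegralZl// -!/(wint mu u _) J1 J0 mulr0 subr0.
move=> N0.
have /ae_eq_integral_abs : (\int[mu]_x `|(EFin \o u) x| = 0)%E.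
  rewrite -[LHS]fineK; first by congr EFin; exact: N0.
  exact: (integrable_fin_num measurableT (integrable_abse iu)).
move=> /(_ measurableT (measurable_int _ iu)).
by apply: filterS => x /(_ I) [].
Qed.

End UniquenessTheorem.

(** * Projections onto exponentials and completeness *)

Section Completeness.
Context {R : realType} {d : nat}.
Variable mu : probability (BorelRd R d) R.
Notation T := (BorelRd R d).
Implicit Types (u v h : T -> R) (xi l : 'rV[R]_d) (L : seq 'rV[R]_d).

Lemma bmeas_sum I (s : seq I) (h : I -> T -> R) :
  (forall i, bmeas (h i)) -> bmeas (fun x => \sum_(i <- s) h i x).
Proof.
move=> bh; elim: s => [|i s IH].
  by under eq_fun do rewrite big_nil; exact: bmeas_cst.
by under eq_fun do rewrite big_cons; exact: bmeasD.
Qed.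

Lemma wint_sum u I (s : seq I) (h : I -> T -> R) : mu.-integrable setT (EFin \o u) ->
  (forall i, bmeas (h i)) ->
  wint mu u (fun x => \sum_(i <- s) h i x) = \sum_(i <- s) wint mu u (h i).
Proof.
move=> iu bh; elim: s => [|i s IH].
  under eq_wint do rewrite big_nil.
  rewrite big_nil -[RHS](mul0r (wint mu u (fun=> 0))) -wintZ//; last exact: bmeas_cst.
  by apply: eq_wint => x; rewrite mul0r.
under eq_wint do rewrite big_cons.
by rewrite wintD// ?IH ?big_cons//; exact: bmeas_sum.
Qed.

Lemma integrable1 : mu.-integrable setT (EFin \o (fun=> 1) : T -> \bar R).
Proof. exact: finite_measure_integrable_cst. Qed.

(** Expressed by [wint] with weight 1 so that its linearity lemmas apply. *)
Definition mean h : R := wint mu (fun=> 1) h.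

Lemma meanE h : mean h = \int[mu]_x h x.
Proof. by apply: eq_Rintegral => x _; rewrite mul1r. Qed.

Lemma integrable_bmeas h : bmeas h -> mu.-integrable setT (EFin \o h).
Proof.
move=> bh; have := integrable_wint mu _ integrable1 h bh.
by apply: eq_integrable => // x _ /=; rewrite mul1r.
Qed.

Lemma mean1 : mean (fun=> 1) = 1.
Proof.
rewrite meanE Rintegral_cst// mul1r.
exact: (congr1 fine (probability_setT mu)).
Qed.

(** [fc] and [fs] are the real and imaginary parts of the Fourier transform with kernel exp(2 pi i
    xi.x). *)
Definition fc xi := mean (ecos xi).
Definition fs xi := mean (esin xi).

Lemma fcN xi : fc (- xi) = fc xi.
Proof. by apply: eq_wint => x; rewrite /ecos dotpNl mulrN cosN. Qed.

Lemma fsN xi : fs (- xi) = - fs xi.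
Proof.
rewrite -[RHS]mulN1r -wintZ//; last exact: bmeas_esin.
  by apply: eq_wint => x; rewrite /esin dotpNl mulrN sinN mulN1r.
exact: integrable1.
Qed.

Lemma fc0 : fc 0 = 1.
Proof. by rewrite -[RHS]mean1; apply: eq_wint => x; rewrite /ecos dotp0l mulr0 cos0. Qed.

Lemma fs0 : fs 0 = 0.
Proof. by have := fsN 0; rewrite oppr0; lra. Qed.

Section Projection.
Variables (L : seq 'rV[R]_d) (xi : 'rV[R]_d).
Hypothesis uL : uniq L.
Hypothesis orthoL : {in L &, forall l l', fc (l - l') = (l == l')%:R /\ fs (l - l') = 0}.

Let C l := fc (xi - l).
Let S l := fs (xi - l).

(* Real and imaginary parts of e_xi minus its projection on the span of L. *)
Definition res1 (x : T) : R := ecos xi x - \sum_(l <- L) (C l * ecos l x - S l * esin l x).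
Definition res2 (x : T) : R := esin xi x - \sum_(l <- L) (C l * esin l x + S l * ecos l x).

Let bC := bmeas_ecos (R := R) (d := d).
Let bS := bmeas_esin (R := R) (d := d).

Lemma bmeasZ (c : R) h : bmeas h -> bmeas (fun x => c * h x).
Proof. by move=> bh; apply: bmeasM => //; exact: bmeas_cst. Qed.

Lemma bmeasN h : bmeas h -> bmeas (fun x => - h x).
Proof.
move=> bh; have -> : (fun x => - h x) = (fun x => -1 * h x).
  by apply: funext => x; rewrite mulN1r.
exact: bmeasZ.
Qed.

Lemma bmeas_res1 : bmeas res1.
Proof.
apply: bmeasD => //; apply: bmeasN; apply: bmeas_sum => l.
by apply: bmeasD; [|apply: bmeasN]; exact: bmeasZ.
Qed.

Lemma bmeas_res2 : bmeas res2.
Proof.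
apply: bmeasD => //; apply: bmeasN; apply: bmeas_sum => l.
by apply: bmeasD; exact: bmeasZ.
Qed.

Lemma wint_res1 u : mu.-integrable setT (EFin \o u) -> wint mu u res1 =
  wint mu u (ecos xi) - \sum_(l <- L) (C l * wint mu u (ecos l) - S l * wint mu u (esin l)).
Proof.
move=> iu.
have bl l : bmeas (fun x => C l * ecos l x + (- S l) * esin l x).
  by apply: bmeasD; exact: bmeasZ.
rewrite (eq_wint _ _ _ (fun x => ecos xi x + (-1) * \sum_(l <- L) (C l * ecos l x + (- S l) * esin l x))).
  rewrite wintD//; last by apply: bmeasZ; exact: bmeas_sum.
  rewrite wintZ//; last exact: bmeas_sum.
  rewrite mulN1r wint_sum//; congr (_ - _); apply: eq_bigr => l _.
  by rewrite wintD//; [rewrite !wintZ// mulNr|exact: bmeasZ..].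
by move=> x; rewrite mulN1r; congr (_ - _); apply: eq_bigr => l _; rewrite mulNr.
Qed.

Lemma wint_res2 u : mu.-integrable setT (EFin \o u) -> wint mu u res2 =
  wint mu u (esin xi) - \sum_(l <- L) (C l * wint mu u (esin l) + S l * wint mu u (ecos l)).
Proof.
move=> iu.
have bl l : bmeas (fun x => C l * esin l x + S l * ecos l x).
  by apply: bmeasD; exact: bmeasZ.
rewrite (eq_wint _ _ _ (fun x => esin xi x + (-1) * \sum_(l <- L) (C l * esin l x + S l * ecos l x))).
  rewrite wintD//; last by apply: bmeasZ; exact: bmeas_sum.
  rewrite wintZ//; last exact: bmeas_sum.
  rewrite mulN1r wint_sum//; congr (_ - _); apply: eq_bigr => l _.
  by rewrite wintD//; [rewrite !wintZ//|exact: bmeasZ..].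
by move=> x; rewrite mulN1r.
Qed.

(** Pythagoras: the cross terms [cr] remove the sum of squared coefficients twice, and by
    orthonormality the Gram terms [sq] restore it once. *)
Lemma residue_norm :
  mean (fun x => res1 x ^+ 2 + res2 x ^+ 2) = 1 - \sum_(l <- L) (C l ^+ 2 + S l ^+ 2).
Proof.
pose cr l (x : T) := C l * ecos (xi - l) x + S l * esin (xi - l) x.
pose sq l l' (x : T) := (C l * C l' + S l * S l') * ecos (l - l') x +
  (C l * S l' - S l * C l') * esin (l - l') x.
have bcr l : bmeas (cr l) by apply: bmeasD; exact: bmeasZ.
have bsq l l' : bmeas (sq l l') by apply: bmeasD; exact: bmeasZ.
have E x : res1 x ^+ 2 + res2 x ^+ 2 = 1 +
    ((-2) * \sum_(l <- L) cr l x + \sum_(l <- L) \sum_(l' <- L) sq l l' x).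
  rewrite /res1 /res2.
  set c := ecos xi x; set s := esin xi x.
  pose a l := C l * ecos l x - S l * esin l x.
  pose b l := C l * esin l x + S l * ecos l x.
  have -> : \sum_(l <- L) cr l x = c * (\sum_(l <- L) a l) + s * (\sum_(l <- L) b l).
    rewrite !mulr_sumr -big_split; apply: eq_bigr => l _ /=.
    by rewrite /cr ecosBl esinBl -/c -/s /a /b; ring.
  have -> : \sum_(l <- L) \sum_(l' <- L) sq l l' x =
      (\sum_(l <- L) a l) ^+ 2 + (\sum_(l <- L) b l) ^+ 2.
    rewrite !expr2 !mulr_suml -big_split; apply: eq_bigr => l _ /=.
    rewrite !mulr_sumr -big_split; apply: eq_bigr => l' _ /=.
    by rewrite /sq ecosBl esinBl /a /b; ring.
  have H : c ^+ 2 + s ^+ 2 = 1 by exact: cos2Dsin2.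
  rewrite -/(\sum_(l <- L) a l) -/(\sum_(l <- L) b l) -{1}H; ring.
have bsum : bmeas (fun x => \sum_(l <- L) \sum_(l' <- L) sq l l' x).
  by apply: bmeas_sum => l; exact: bmeas_sum.
have i1 := integrable1.
rewrite /mean (eq_wint _ _ _ _ E) wintD//; [|exact: bmeas_cst|]; last first.
  by apply: bmeasD => //; apply: bmeasZ; exact: bmeas_sum.
rewrite wintD//; last by apply: bmeasZ; exact: bmeas_sum.
rewrite wintZ//; last exact: bmeas_sum.
rewrite -/(mean _) mean1 !wint_sum// => [|l]; last exact: bmeas_sum.
have -> : \sum_(l <- L) wint mu (fun=> 1) (cr l) = \sum_(l <- L) (C l ^+ 2 + S l ^+ 2).
  apply: eq_bigr => l _; rewrite wintD//; [|exact: bmeasZ..].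
  by rewrite !wintZ// -!/(mean _) -/(fc _) -/(fs _) -/(C l) -/(S l) !expr2.
have -> : \sum_(l <- L) wint mu (fun=> 1) (fun x => \sum_(l' <- L) sq l l' x) =
    \sum_(l <- L) (C l ^+ 2 + S l ^+ 2).
  rewrite big_seq [RHS]big_seq; apply: eq_bigr => l lL; rewrite wint_sum//.
  have W l' : l' \in L -> wint mu (fun=> 1) (sq l l') =
      (C l * C l' + S l * S l') * (l == l')%:R.
    move=> l'L; rewrite wintD//; [|exact: bmeasZ..].
    rewrite !wintZ// -!/(mean _) -/(fc _) -/(fs _).
    by have [-> ->] := orthoL l l' lL l'L; rewrite mulr0 addr0.
  rewrite (bigD1_seq l)//= W// eqxx mulr1 big_seq_cond big1 ?addr0 ?expr2//.
  by move=> l' /andP[l'L /negPf]; rewrite eq_sym W// => ->; rewrite mulr0.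
ring.
Qed.

End Projection.

Lemma square_integrable (w : T -> R) : measurable_fun setT w ->
  mu.-integrable setT (fun x => (w x ^+ 2)%:E) -> mu.-integrable setT (EFin \o w).
Proof.
move=> mw iw2.
have := integrableD measurableT iw2 integrable1.
apply: le_integrable => //; first exact/measurable_EFinP.
move=> x _ /=; rewrite lee_fin.
have s0 := sqr_ge0 (w x); rewrite (ger0_norm (addr_ge0 s0 ler01)).
rewrite ler_norml; apply/andP; split; nra.
Qed.

Variables (u v : T -> R).
Hypothesis mu_u : measurable_fun setT u.
Hypothesis mu_v : measurable_fun setT v.
Hypothesis iu2 : mu.-integrable setT (fun x => (u x ^+ 2)%:E).
Hypothesis iv2 : mu.-integrable setT (fun x => (v x ^+ 2)%:E).

Let iu := square_integrable u mu_u iu2.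
Let iv := square_integrable v mu_v iv2.

(** Real part of the inner product of u + i v with e_xi; [inner_im] is the imaginary part. *)
Definition inner_re xi := wint mu u (ecos xi) + wint mu v (esin xi).
Definition inner_im xi := wint mu v (ecos xi) - wint mu u (esin xi).

(** Cauchy-Schwarz in weighted form, which avoids square roots; t will match a residue of squared
    norm at most t^2. *)
Lemma young (t : R) (h g : T -> R) : 0 < t -> bmeas h -> bmeas g ->
  `|wint mu u h + wint mu v g| <=
    t / 2 * (\int[mu]_x (u x ^+ 2) + \int[mu]_x (v x ^+ 2))
    + (2 * t)^-1 * mean (fun x => h x ^+ 2 + g x ^+ 2).
Proof.
move=> t0 bh bg.
have ih := integrable_wint mu u iu h bh; have ig := integrable_wint mu v iv g bg.
have b2 : bmeas (fun x => h x ^+ 2 + g x ^+ 2).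
  by apply: bmeasD; [have := bmeasM h h bh bh|have := bmeasM g g bg bg].
have i2 : mu.-integrable setT (EFin \o (fun x => t / 2 * (u x ^+ 2 + v x ^+ 2))).
  have := integrableZl measurableT (t / 2) (integrableD measurableT iu2 iv2).
  by apply: eq_integrable.
have i3 : mu.-integrable setT (EFin \o (fun x => (2 * t)^-1 * (h x ^+ 2 + g x ^+ 2))).
  by apply: integrable_bmeas; exact: bmeasZ.
have iL : mu.-integrable setT (EFin \o (fun x => u x * h x + v x * g x)).
  by have := integrableD measurableT ih ig; apply: eq_integrable.
have iR : mu.-integrable setT (EFin \o (fun x => t / 2 * (u x ^+ 2 + v x ^+ 2) +
    (2 * t)^-1 * (h x ^+ 2 + g x ^+ 2))).
  by have := integrableD measurableT i2 i3; apply: eq_integrable.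
rewrite /wint -(RintegralD measurableT ih ig); apply: (le_trans (le_normr_Rintegral measurableT iL)).
have -> : t / 2 * (\int[mu]_x (u x ^+ 2) + \int[mu]_x (v x ^+ 2))
    + (2 * t)^-1 * mean (fun x => h x ^+ 2 + g x ^+ 2) =
    \int[mu]_x (t / 2 * (u x ^+ 2 + v x ^+ 2) + (2 * t)^-1 * (h x ^+ 2 + g x ^+ 2)).
  rewrite RintegralD// RintegralZl//; last first.
    by have := integrableD measurableT iu2 iv2; apply: eq_integrable.
  rewrite RintegralD// RintegralZl//; last exact: integrable_bmeas.
  by rewrite meanE.
apply: le_Rintegral => //.
  by have := integrable_abse iL; apply: eq_integrable.
have Y (a b : R) : `|a * b| <= t / 2 * a ^+ 2 + (2 * t)^-1 * b ^+ 2.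
  have E : t / 2 * a ^+ 2 + (2 * t)^-1 * b ^+ 2 = (2 * t)^-1 * ((t * a) ^+ 2 + b ^+ 2).
    by field; rewrite gt_eqF.
  rewrite E ler_pdivlMl ?mulr_gt0// normrM.
  have := sqr_ge0 (t * `|a| - `|b|).
  have := real_normK (num_real a); have := real_normK (num_real b).
  by rewrite !exprMn => <- <-; nra.
move=> x _; rewrite (le_trans (ler_normD _ _))//.
have := Y (u x) (h x); have := Y (v x) (g x); lra.
Qed.

(** Orthogonality to the frequencies of [LL j] allows e_xi to be replaced with its residue, whose
    norm is arbitrarily small. *)
Lemma inner_eq0 (LL : nat -> seq 'rV[R]_d) :
  (forall j, uniq (LL j)) ->
  (forall j, {in LL j &, forall l l', fc (l - l') = (l == l')%:R /\ fs (l - l') = 0}) ->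
  (forall xi c, 0 < c -> exists j,
     1 - c <= \sum_(l <- LL j) (fc (xi - l) ^+ 2 + fs (xi - l) ^+ 2)) ->
  (forall j l, l \in LL j -> inner_re l = 0 /\ inner_im l = 0) ->
  forall xi, inner_re xi = 0 /\ inner_im xi = 0.
Proof.
move=> uLL oLL tot H0 xi.
set K := \int[mu]_x (u x ^+ 2) + \int[mu]_x (v x ^+ 2).
have K0 : 0 <= K by rewrite addr_ge0// Rintegral_ge0// => x _; exact: sqr_ge0.
have small (a : R) : (forall t, 0 < t -> `|a| <= t / 2 * (K + 1)) -> a = 0.
  move=> Ha; apply/eqP; rewrite -normr_eq0 eq_le normr_ge0 andbT.
  apply/ler_addgt0Pl => e e0; rewrite addr0.
  have K1 : 0 < K + 1 by lra.
  have := Ha _ (divr_gt0 e0 K1).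
  have -> : e / (K + 1) / 2 * (K + 1) = e / 2 by field; rewrite gt_eqF.
  lra.
have bound t : 0 < t -> exists h g, [/\ bmeas h, bmeas g,
    mean (fun x => h x ^+ 2 + g x ^+ 2) <= t ^+ 2,
    inner_re xi = wint mu u h + wint mu v g &
    inner_im xi = wint mu v h - wint mu u g].
  move=> t0; have t20 : 0 < t ^+ 2 by rewrite exprn_gt0.
  have [j Hj] := tot xi _ t20.
  exists (res1 (LL j) xi), (res2 (LL j) xi); split.
  - exact: bmeas_res1.
  - exact: bmeas_res2.
  - by rewrite residue_norm//; lra.
  - rewrite wint_res1// wint_res2// addrACA -opprD -big_split /= big_seq big1 ?subr0//.
    move=> l /H0[]; rewrite /inner_re /inner_im => E1 E2.
    have -> : wint mu u (ecos l) = - wint mu v (esin l) by lra.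
    have -> : wint mu v (ecos l) = wint mu u (esin l) by lra.
    ring.
  - rewrite wint_res1// wint_res2//.
    have -> : \sum_(l <- LL j) (fc (xi - l) * wint mu v (ecos l) - fs (xi - l) * wint mu v (esin l)) =
        \sum_(l <- LL j) (fc (xi - l) * wint mu u (esin l) + fs (xi - l) * wint mu u (ecos l)).
      apply: eq_big_seq => l /H0[]; rewrite /inner_re /inner_im => E1 E2.
      have -> : wint mu u (ecos l) = - wint mu v (esin l) by lra.
      have -> : wint mu v (ecos l) = wint mu u (esin l) by lra.
      by rewrite mulrN.
    by rewrite /inner_im; ring.
have fin t (G : R) : 0 < t -> G <= t ^+ 2 -> t / 2 * K + (2 * t)^-1 * G <= t / 2 * (K + 1).
  move=> t0 Gt; have -> : t / 2 * (K + 1) = t / 2 * K + t / 2 by ring.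
  rewrite lerD2l.
  by rewrite ler_pdivrMl ?mulr_gt0//; nra.
split; apply: small => t t0; have [h [g [bh bg Gt Ere Eim]]] := bound t t0.
  by rewrite Ere (le_trans (young _ _ _ t0 bh bg))// fin.
(* The imaginary part has the form required by [young] for the pair (-g, h). *)
have bNg := bmeasN g bg.
rewrite Eim addrC (_ : - wint mu u g = wint mu u (fun x => - g x)); last first.
  rewrite -mulN1r -wintZ//; apply: eq_wint => x; by rewrite mulN1r.
rewrite (le_trans (young _ _ _ t0 bNg bh))// fin//.
rewrite (_ : mean _ = mean (fun x => h x ^+ 2 + g x ^+ 2))//.
by apply: eq_wint => x; rewrite sqrrN addrC.
Qed.

(** Comparing xi with -xi, where cosine is even and sine odd, separates u from v. *)
Lemma inner_uniqueness : (forall xi, inner_re xi = 0 /\ inner_im xi = 0) ->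
  {ae mu, forall x, u x = 0 /\ v x = 0}.
Proof.
move=> H.
have N w xi : mu.-integrable setT (EFin \o w) ->
    wint mu w (ecos (- xi)) = wint mu w (ecos xi) /\
    wint mu w (esin (- xi)) = - wint mu w (esin xi).
  move=> iw; split; first by apply: eq_wint => x; rewrite /ecos dotpNl mulrN cosN.
  rewrite -[RHS]mulN1r -wintZ//; last exact: bmeas_esin.
  by apply: eq_wint => x; rewrite /esin dotpNl mulrN sinN mulN1r.
have H' xi : [/\ wint mu u (ecos xi) = 0, wint mu u (esin xi) = 0,
    wint mu v (ecos xi) = 0 & wint mu v (esin xi) = 0].
  have := H xi; have := H (- xi); rewrite /inner_re /inner_im.
  have [-> ->] := N u xi iu; have [-> ->] := N v xi iv.
  by move=> [? ?] [? ?]; split; lra.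
have Au : {ae mu, forall x, u x = 0}.
  by apply: fourier_uniqueness => // xi; have [] := H' xi.
have Av : {ae mu, forall x, v x = 0}.
  by apply: fourier_uniqueness => // xi; have [] := H' xi.
by apply: filterS2 Au Av => x -> ->.
Qed.

End Completeness.

(** Testing the norm bound on a basis vector bounds (m n i)^2, which dominates m n i. *)
Lemma bounded_radices (R : realType) (d : nat) (m : nat -> 'I_d -> nat) :
  (exists M : R, forall n (x : 'rV[R]_d),
      sqnorm (mxapp (diagR R (m n)) x) <= M * sqnorm x) ->
  exists2 M : nat, (0 < M)%N & forall n i, (m n i <= M)%N.
Proof.
move=> [M HM].
have [K _ /(_ K (leqnn K)) /= HK] := nbhs_infty_gtr M.
exists K.+1 => // n i.
have := HM n (delta_mx 0 i).
have -> : mxapp (diagR R (m n)) (delta_mx 0 i) = (m n i)%:R *: delta_mx 0 i.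
  rewrite /mxapp trmx_delta; apply/rowP => j; rewrite mxE mul_diag_mx !mxE.
  by have [->|ji] := eqVneq j i; rewrite ?mulr0.
have sq c : sqnorm (c *: delta_mx 0 i : 'rV[R]_d) = c ^+ 2.
  rewrite /sqnorm (bigD1 i)//= !mxE !eqxx mulr1 big1 ?addr0// => j ji.
  by rewrite !mxE (negPf ji) andbF mulr0 expr0n.
rewrite sq -[X in sqnorm X]scale1r sq expr1n mulr1 => H.
have : (m n i ^ 2)%:R < K%:R :> R by rewrite natrX (le_lt_trans H HK).
rewrite ltr_nat => mK; apply: leq_trans (leqnSn K); apply: leq_trans (ltnW mK).
by case: (m n i) => // k; rewrite expnS leq_pmulr// expn_gt0.
Qed.

(** * Application to the infinite convolution *)

Section WeakLimit.
Context {R : realType} {d : nat}.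
Variables (m : nat -> 'I_d -> nat) (B : nat -> seq 'rV[int]_d).
Variable mu : probability (BorelRd R d) R.
Hypothesis wl : weak_limit m B mu.

Lemma integral_mean (h : BorelRd R d -> R) : bmeas h ->
  (\int[mu]_x (h x)%:E = (mean mu h)%:E)%E.
Proof.
move=> bh; rewrite meanE /Rintegral fineK//.
exact: (integrable_fin_num measurableT (integrable_bmeas mu h bh)).
Qed.

Lemma weak_limit_mean (h : 'rV[R]_d -> R) : continuous h -> bmeas h ->
  mu_n_int m B n h @[n --> \oo] --> mean mu h.
Proof.
move=> ch bh; have := wl h ch bh.2.
by rewrite integral_mean// => /fine_cvg.
Qed.

Lemma Fn_cvg_fourier (xi : 'rV[R]_d) :
  (fun n => Fn m B n xi) @ \oo --> fc mu xi ^+ 2 + fs mu xi ^+ 2.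
Proof.
under eq_fun do rewrite FnE.
have Hc := weak_limit_mean _ (continuous_ecos xi) (bmeas_ecos xi).
have Hs := weak_limit_mean _ (continuous_esin xi) (bmeas_esin xi).
rewrite !expr2; under eq_fun do rewrite !expr2.
by apply: cvgD; apply: cvgM.
Qed.

End WeakLimit.

(* Sequence indexed from 0: (R_n, B_n) = (diagR (m n), B n). *)
Theorem theorem1p7 (R : realType) (d : nat)
    (m : nat -> 'I_d -> nat) (B : nat -> seq 'rV[int]_d) :
  (forall n, in_Dd (m n) (B n)) ->
  (forall n, admissible (diagR R (m n)) (B n)) ->
  (* sup_n ||R_n|| < oo  (operator norm w.r.t. the Euclidean norm, squared) *)
  (exists M : R, forall n (x : 'rV[R]_d),
      sqnorm (mxapp (diagR R (m n)) x) <= M * sqnorm x) ->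
  forall mu : probability (BorelRd R d) R,
    weak_limit m B mu ->
    exists Lam : set 'rV[R]_d, in_Zd Lam /\ spectrum_of mu Lam.
Proof.
move=> mB admB /bounded_radices[M M0 mM] mu wl.
pose phi xi := fc mu xi ^+ 2 + fs mu xi ^+ 2.
have [LL [uLL subLL oLL totLL]] :=
  spectrum_exists m B mB admB M M0 mM phi (Fn_cvg_fourier m B mu wl).
pose Lam : set 'rV[R]_d := [set x | exists j l, l \in LL j /\ x = vecZ R l].
have ortho j : {in LL j &, forall l l',
    fc mu (vecZ R l - vecZ R l') = (vecZ R l == vecZ R l')%:R /\
    fs mu (vecZ R l - vecZ R l') = 0}.
  move=> l l' lL l'L; have [->|ll'] := eqVneq l l'.
    by rewrite subrr eqxx fc0 fs0.
  rewrite (inj_eq (@vecZ_inj R d)) (negPf ll').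
  have /eqP := oLL j l l' lL l'L ll'; rewrite paddr_eq0 ?sqr_ge0//.
  by rewrite !sqrf_eq0 => /andP[/eqP -> /eqP ->].
exists Lam; split.
  by move=> _ [j [l [_ ->]]] i; rewrite mxE intr_int.
split; last split.
- apply: (@sub_countable _ _ _ [set: 'rV[int]_d]); last exact: countableP.
  apply: card_le_trans (card_image_le (@vecZ R d) setT); apply: subset_card_le.
  by move=> _ [j [l [_ ->]]]; exists l.
- move=> _ _ [j [l [lL ->]]] [j' [l' [l'L ->]]].
  have lJ := subLL _ _ (leq_maxl j j') _ lL.
  have l'J := subLL _ _ (leq_maxr j j') _ l'L.
  have [Ec Es] := ortho _ _ _ lJ l'J.
  have Hc := integral_mean mu _ (bmeas_ecos (vecZ R l - vecZ R l')).
  have Hs := integral_mean mu _ (bmeas_esin (vecZ R l - vecZ R l')).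
  by split; [rewrite -Ec|rewrite -Es].
move=> u v mu_u mu_v iu2 iv2 H.
apply: inner_uniqueness => //.
apply: (inner_eq0 mu u v mu_u mu_v iu2 iv2 (fun j => [seq vecZ R l | l <- LL j])).
- by move=> j; rewrite map_inj_uniq//; exact: vecZ_inj.
- by move=> j _ _ /mapP[l lL ->] /mapP[l' l'L ->]; exact: ortho lL l'L.
(* The sums of [phi] are taken at xi + l, the projection coefficients at xi - l; since [phi] is
   even, passing to -xi reconciles them. *)
- move=> xi c c0; have [j Hj] := totLL (- xi) c c0; exists j.
  rewrite big_map (le_trans Hj)//; apply: ler_sum => l _.
  rewrite /phi (_ : - xi + _ = - (xi - vecZ R l)); last by rewrite opprB addrC.
  by rewrite fcN fsN sqrrN.
move=> j _ /mapP[l lL ->]; have [] := H (vecZ R l); first by exists j, l.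
have iu := square_integrable mu u mu_u iu2.
have iv := square_integrable mu v mu_v iv2.
have bC := bmeas_ecos (vecZ R l); have bS := bmeas_esin (vecZ R l).
move=> /(congr1 fine) Hre /(congr1 fine) Him; split.
  rewrite -[RHS]Hre /inner_re /wint -RintegralD//; exact: integrable_wint.
rewrite -[RHS]Him /inner_im /wint -RintegralB//; exact: integrable_wint.
Qed.
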